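(* For every $f\in C^1_b(\mathbb R^d)$, $p\in[2,+\infty)$ and $t,s\in I$ with $t\ge s$, we have (pointwise in $\mathbb R^d$) $$G(t,s)(|f|^p\log|f|^p)\le\frac{p^2\Lambda}{|r_0|}\left(1-e^{2r_0(t-s)}\right)G(t,s)(|f|^{p-2}|\nabla f|^2)+(G(t,s)|f|^p)\log(G(t,s)|f|^p).$$
   Context: Setting. $I$ is an open right halfline, and for $t\in I$, $(\mathcal A(t)\zeta)(x)=\mathrm{Tr}(Q(t)D^2\zeta(x))+\langle b(t,x),\nabla\zeta(x)\rangle$, $x\in\mathbb R^d$, where $Q=[q_{ij}]$ and $b=(b_1,\dots,b_d)$. Standing assumptions: (i) for some $\theta\in(0,1)$, $q_{ij}\in C^{\theta/2}_{\rm loc}(I)$ and $b_i\in C^{\theta/2,\theta}_{\rm loc}(I\times\mathbb R^d)$ (locally parabolic H\''older); (ii) $Q(t)$ is symmetric and there are $0<\eta_0<\Lambda$ with $\eta_0|\xi|^2\le\langle Q(t)\xi,\xi\rangle\le\Lambda|\xi|^2$ for all $t\in I$, $\xi\in\mathbb R^d$; (iii) there are a positive $\varphi\in C^2(\mathbb R^d)$ with $\varphi(x)\to+\infty$ as $|x|\to+\infty$ and constants $a,\gamma>0$ with $(\mathcal A(t)\varphi)(x)\le a-\gamma\varphi(x)$ for all $(t,x)\in I\times\mathbb R^d$; (iv) the first order spatial derivatives of $b_i$ exist and belong to $C^{\theta/2,\theta}_{\rm loc}(I\times\mathbb R^d)$, and there is $r_0<0$ with $\langle\nabla_xb(t,x)\xi,\xi\rangle\le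 r_0|\xi|^2$ for all $(t,x)\in I\times\mathbb R^d$, $\xi\in\mathbb R^d$. For $s\in I$ and $f\in C_b(\mathbb R^d)$, $G(\cdot,s)f\in C_b([s,+\infty)\times\mathbb R^d)\cap C^{1+\theta/2,2+\theta}_{\rm loc}((s,+\infty)\times\mathbb R^d)$ denotes the unique bounded classical solution of $D_tu=\mathcal A(t)u$ in $(s,+\infty)\times\mathbb R^d$, $u(s,\cdot)=f$. $C^1_b(\mathbb R^d)$ is the space of bounded $C^1$ functions with bounded first order derivatives. $0\log0=0$. *)

(* Defs.v *)
From HB Require Import structures.
From mathcomp Require Import all_boot all_order all_algebra.
From mathcomp Require Import all_classical all_reals all_analysis.

Set Implicit Arguments.
Unset Strict Implicit.
Unset Printing Implicit Defensive.

Import Order.TTheory GRing.Theory Num.Theory numFieldNormedType.Exports.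

Local Open Scope classical_set_scope.
Local Open Scope ring_scope.

(* Points of R^d are row vectors ['rV[R]_d].  The library norm [`|x|] on
   ['rV[R]_d] is the sup norm; every |x| and <x, y> here is Euclidean
   and is written [enorm x] and [dotp x y]. *)

Section EvolutionOperator.
Context {R : realType} {d : nat}.
Implicit Types (f : 'rV[R]_d -> R) (u : R -> 'rV[R]_d -> R) (J : set R).

Definition dotp (x y : 'rV[R]_d) : R := \sum_i x 0 i * y 0 i.

Definition enorm (x : 'rV[R]_d) : R := Num.sqrt (dotp x x).

Definition unit_vec (i : 'I_d) : 'rV[R]_d := delta_mx 0 i.

Definition partial (i : 'I_d) f : 'rV[R]_d -> R := 'D_(unit_vec i) f.

Definition grad f (x : 'rV[R]_d) : 'rV[R]_d := \row_i partial i f x.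

Definition hess f (x : 'rV[R]_d) : 'M[R]_d :=
  \matrix_(i, j) partial i (partial j f) x.

Definition C1 f : Prop :=
  continuous f /\
  forall i, (forall x, derivable f x (unit_vec i)) /\ continuous (partial i f).

Definition C2 f : Prop := C1 f /\ forall i, C1 (partial i f).

Definition Cb f : Prop := continuous f /\ [bounded f x | x in setT].

Definition C1b f : Prop :=
  [/\ C1 f, [bounded f x | x in setT]
    & forall i, [bounded partial i f x | x in setT]].

(* C^alpha_loc(J) *)
Definition holder_loc (alpha : R) J (g : R -> R) : Prop :=
  forall K : set R, compact K -> K `<=` J ->
    exists C : R, forall t r, K t -> K r ->
      `|g t - g r| <= C * `|t - r| `^ alpha.

(* C^{theta/2,theta}_loc(J x R^d) *)
Definition parabolic_holder_loc (theta : R) J u : Prop :=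
  forall K : set (R * 'rV[R]_d), compact K -> K `<=` J `*` setT ->
    exists C : R, forall y z, K y -> K z ->
      `|u y.1 y.2 - u z.1 z.2|
        <= C * (`|y.1 - z.1| `^ (theta / 2) + enorm (y.2 - z.2) `^ theta).

Definition Dt u (t : R) (x : 'rV[R]_d) : R := derive1 (fun r : R => u r x) t.

(* C^{1+theta/2,2+theta}_loc(J x R^d), for J open *)
Record parabolic_C12_holder_loc (theta : R) J u : Prop := {
  pC12_derivable_t : forall t x, J t -> derivable (fun r : R => u r x) t 1 ;
  pC12_derivable_x : forall t x i, J t -> derivable (u t) x (unit_vec i) ;
  pC12_derivable_xx : forall t x i j, J t ->
    derivable (partial j (u t)) x (unit_vec i) ;
  pC12_holder : parabolic_holder_loc theta J u ;
  pC12_holder_t : parabolic_holder_loc theta J (Dt u) ;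
  pC12_holder_x : forall i,
    parabolic_holder_loc theta J (fun t => partial i (u t)) ;
  pC12_holder_xx : forall i j,
    parabolic_holder_loc theta J (fun t => partial i (partial j (u t))) }.

Section Coefficients.
Variables (Q : R -> 'M[R]_d) (b : R -> 'rV[R]_d -> 'rV[R]_d).

(* (A(t) f)(x) *)
Definition opA (t : R) f (x : 'rV[R]_d) : R :=
  \tr (Q t *m hess f x) + dotp (b t x) (grad f x).

Definition b_comp (i : 'I_d) (t : R) (x : 'rV[R]_d) : R := b t x 0 i.

(* Row i of the Jacobian matrix of b(t, .) is the gradient of b_i(t, .). *)
Definition jac_b (t : R) (x : 'rV[R]_d) : 'M[R]_d :=
  \matrix_(i, j) partial j (b_comp i t) x.

(* <M xi, xi>; since xi is a row vector, M xi is [(M *m xi^T)^T]. *)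
Definition quad_form (M : 'M[R]_d) (xi : 'rV[R]_d) : R :=
  dotp (M *m xi^T)^T xi.

Definition coef_regular (theta : R) J : Prop :=
  (forall i j, holder_loc (theta / 2) J (fun t => Q t i j)) /\
  (forall i, parabolic_holder_loc theta J (b_comp i)).

Definition uniformly_elliptic (eta0 Lambda : R) J : Prop :=
  forall t, J t -> (Q t)^T = Q t /\
    forall xi, eta0 * enorm xi ^+ 2 <= quad_form (Q t) xi <= Lambda * enorm xi ^+ 2.

Definition has_lyapunov J : Prop :=
  exists (phi : 'rV[R]_d -> R) (a gamma : R),
    [/\ C2 phi /\ (forall x, 0 < phi x),
        (forall M : R, exists r : R, forall x, r <= enorm x -> M <= phi x),
        0 < a /\ 0 < gamma
      & forall t x, J t -> opA t phi x <= a - gamma * phi x].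

Definition drift_dissipative (theta r0 : R) J : Prop :=
  [/\ forall i j t x, J t -> derivable (b_comp i t) x (unit_vec j),
      forall i j, parabolic_holder_loc theta J (fun t => partial j (b_comp i t))
    & forall t x, J t -> forall xi, quad_form (jac_b t x) xi <= r0 * enorm xi ^+ 2].

(* u is a bounded classical solution of D_t u = A(t) u in (s, +oo) x R^d,
   u(s, .) = f, with the stated interior regularity. *)
Record bounded_classical_solution (theta s : R) f u : Prop := {
  bcs_continuous : {within `[s, +oo[%classic `*` setT,
    continuous (fun y : R * 'rV[R]_d => u y.1 y.2)} ;
  bcs_bounded : [bounded u y.1 y.2 | y in `[s, +oo[%classic `*` setT] ;
  bcs_regular : parabolic_C12_holder_loc theta `]s, +oo[%classic u ;
  bcs_equation : forall t x, s < t -> Dt u t x = opA t (u t) x ;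
  bcs_initial : u s = f }.

Definition evolution_operator (theta : R) J
    (G : R -> R -> ('rV[R]_d -> R) -> 'rV[R]_d -> R) : Prop :=
  forall s f, J s -> Cb f ->
    bounded_classical_solution theta s f (fun t => G t s f).

End Coefficients.
End EvolutionOperator.

Definition open_right_halfline (R : realType) (J : set R) : Prop :=
  exists c : R, J = `]c, +oo[%classic.

(* Main.v *)
Require Import Defs.
From mathcomp Require Import all_boot all_order all_algebra.
From mathcomp Require Import all_classical all_reals all_analysis.
From mathcomp Require Import ring lra.
Import Order.TTheory GRing.Theory Num.Theory numFieldNormedType.Exports.
Local Open Scope classical_set_scope.
Local Open Scope ring_scope.

Set Implicit Arguments.
Unset Strict Implicit.
Unset Printing Implicit Defensive.

(** Put [u = G(t,s)|f|^p], [v = G(t,s)(|f|^p log |f|^p)] and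
    [h = G(t,s)(|f|^(p-2) |grad f|^2)]. The function

      [w = v - u log u - c(t) h],  [c(t) = (p^2 Lambda / |r0|) (1 - exp(2 r0 (t-s)))],

    vanishes at time [s]. The entropy [u log u] dissipates:
    [(D_t - A)(u log u) = - <Q grad u, grad u> / u], so that
    [(D_t - A) w = <Q grad u, grad u> / u - c'(t) h], where
    [c'(t) = 2 p^2 Lambda exp(2 r0 (t-s))]. By ellipticity this is nonpositive,
    and [w <= 0] by the maximum principle ([comparison]), as soon as

      [|grad u|^2 <= p^2 exp(2 r0 (t-s)) u h]      ([gradient_bound]).

    The classical proof of such a bound differentiates the equation, which requires
    third derivatives of [u]. Here it is obtained by doubling the variables. Since
    [Q] does not depend on [x], two copies of the diffusion driven by the same noise
    approach each other at the rate [r0], their difference having no second-order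
    part. In terms of functions: if [U] is a subsolution, [P] a supersolution and
    [(D_t - A) S >= 2 r0 S], [S >= 0], then the inequality
    [U(t,y) <= P(t,x) + |y-x|^2 S(t,x)] propagates from [t = s] to later times
    ([coupling_comparison]). At a maximum point of the difference of the two sides
    the second-order condition is needed only along the diagonal, and the
    dissipativity of [b] controls the drift.

    At time [s] one has, to first order and by Young's inequality, for all [k > 0],

      [|f(y)|^p - |f(x)|^p <= p |f(x)|^(p-1) |grad f(x)| |y-x| + ...
         <= k |f(x)|^p + (p^2 / 4k) |f(x)|^(p-2) |grad f(x)|^2 |y-x|^2 + ...]

    and both terms on the right propagate: the first as [k u(t,x)], the second as
    [(p^2 / 4k) exp(2 r0 (t-s)) h(t,x) |y-x|^2]. Taking [y - x] small, [k] of the same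
    size as [|y-x|], and optimising gives the gradient bound. The remainder is
    controlled by [e (1 + phi(x)) |y-x| + C |y-x|^2] with [e] arbitrarily small
    ([powR_increment]), and [phi + a (t-s)] is a supersolution; this accounts for
    gradients of [f] that are not uniformly continuous.

    As [u] may vanish, [u log u] is replaced by [(u + e) log (u + e) - e log e] and
    [e] tends to 0 ([entropy_comparison], [le_of_entropy_limit]). *)

(** * Euclidean geometry and directional derivatives *)

Lemma cvg_sumr {R : realType} {T I : Type} {F : set_system T} {FF : Filter F}
    (r : seq I) (f : I -> T -> R) (l : I -> R) :
  (forall i, f i x @[x --> F] --> l i) ->
  \sum_(i <- r) f i x @[x --> F] --> \sum_(i <- r) l i.
Proof.
move=> fl; elim: r => [|i r ih].
  under eq_fun do rewrite big_nil; rewrite big_nil; exact: cvg_cst.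
under eq_fun do rewrite big_cons; rewrite big_cons; exact: cvgD.
Qed.

Section EuclideanNorm.
Context {R : realType} {d : nat}.
Implicit Types x y z : 'rV[R]_d.

Lemma dotpC x y : dotp x y = dotp y x.
Proof. by apply: eq_bigr => i _; rewrite mulrC. Qed.

Lemma dotpDl x y z : dotp (x + y) z = dotp x z + dotp y z.
Proof. by rewrite /dotp -big_split /=; apply: eq_bigr => i _; rewrite mxE mulrDl. Qed.

Lemma dotpZl a x y : dotp (a *: x) y = a * dotp x y.
Proof. by rewrite /dotp mulr_sumr; apply: eq_bigr => i _; rewrite mxE mulrA. Qed.

Lemma dotpDr x y z : dotp x (y + z) = dotp x y + dotp x z.
Proof. by rewrite dotpC dotpDl !(dotpC x). Qed.

Lemma dotpZr a x y : dotp x (a *: y) = a * dotp x y.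
Proof. by rewrite dotpC dotpZl dotpC. Qed.

Lemma dotpNl x y : dotp (- x) y = - dotp x y.
Proof. by rewrite -scaleN1r dotpZl mulN1r. Qed.

Lemma dotpNr x y : dotp x (- y) = - dotp x y.
Proof. by rewrite dotpC dotpNl dotpC. Qed.

Lemma dotp0l x : dotp 0 x = 0.
Proof. by rewrite /dotp big1 // => i _; rewrite mxE mul0r. Qed.

Lemma dotpxx_ge0 x : 0 <= dotp x x.
Proof. by apply: sumr_ge0 => i _; rewrite -expr2 sqr_ge0. Qed.

Lemma sqr_enorm x : enorm x ^+ 2 = dotp x x.
Proof. by rewrite sqr_sqrtr // dotpxx_ge0. Qed.

Lemma enorm_ge0 x : 0 <= enorm x.
Proof. exact: sqrtr_ge0. Qed.

Lemma dotp_unit_vec x i : dotp x (unit_vec i) = x 0 i.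
Proof.
rewrite /dotp (bigD1 i) //= mxE !eqxx mulr1 big1 ?addr0 // => j ji.
by rewrite mxE (negbTE ji) andbF mulr0.
Qed.

Lemma dotp_le_enorm x y : dotp x y <= enorm x * enorm y.
Proof.
have [x0|xN0] := eqVneq (enorm x) 0.
  have : dotp x x = 0 by rewrite -sqr_enorm x0 expr0n.
  move/eqP; rewrite psumr_eq0 => [/allP h|i _]; last by rewrite -expr2 sqr_ge0.
  rewrite x0 mul0r /dotp big1 // => i _.
  have := h i (mem_index_enum _); rewrite /= -expr2 sqrf_eq0 => /eqP ->.
  by rewrite mul0r.
have xp : 0 < enorm x by rewrite lt_def xN0 enorm_ge0.
have [y0|yN0] := eqVneq (enorm y) 0.
  have : dotp y y = 0 by rewrite -sqr_enorm y0 expr0n.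
  move/eqP; rewrite psumr_eq0 => [/allP h|i _]; last by rewrite -expr2 sqr_ge0.
  rewrite y0 mulr0 /dotp big1 // => i _.
  have := h i (mem_index_enum _); rewrite /= -expr2 sqrf_eq0 => /eqP ->.
  by rewrite mulr0.
have yp : 0 < enorm y by rewrite lt_def yN0 enorm_ge0.
have := dotpxx_ge0 (enorm y *: x - enorm x *: y).
rewrite !(dotpDl, dotpDr, dotpNl, dotpNr, dotpZl, dotpZr) -!sqr_enorm (dotpC y x).
move=> h; rewrite -(ler_pM2l (mulr_gt0 xp yp)); nra.
Qed.

Lemma le_norm_enorm x : `|x| <= enorm x.
Proof.
rewrite [leLHS]mx_normrE.
apply/bigmax_leP; split => [|[i j] _]; first exact: enorm_ge0.
rewrite /= ord1 -(ler_pXn2r (n := 2)) ?nnegrE ?enorm_ge0 // sqr_enorm real_normK ?num_real //.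
rewrite /dotp (bigD1 j) //= -expr2 lerDl.
by apply: sumr_ge0 => k _; rewrite -expr2 sqr_ge0.
Qed.

Lemma sum_unit_vec x : x = \sum_i x 0 i *: unit_vec i.
Proof. by rewrite [LHS]row_sum_delta. Qed.

Lemma enorm_continuous : continuous (@enorm R d).
Proof.
move=> x; apply: continuous_comp; last exact: sqrt_continuous.
apply: (@cvg_sumr _ _ _ (nbhs x) _) => i; apply: cvgM; exact: coord_continuous.
Qed.

End EuclideanNorm.

Section C1Functions.
Context {R : realType} {d : nat}.
Implicit Types (f g : 'rV[R]_d -> R) (x v w : 'rV[R]_d).

Lemma is_derive_line f x v h l :
  is_derive (h *: v + x) v f l -> is_derive h 1 (fun s : R => f (s *: v + x)) l.
Proof.
have E : (fun k : R => k^-1 *: (((fun s : R => f (s *: v + x)) \o shift h) (k *: 1) - f (h *: v + x)))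
   = (fun k : R => k^-1 *: ((f \o shift (h *: v + x)) (k *: v) - f (h *: v + x))).
  apply/funext => k /=.
  by rewrite scalerDl addrA [k *: 1]mulr1.
by move=> [d1 d2]; split; [rewrite /derivable E | rewrite /derive E].
Qed.


Lemma MVT_from0 (phi dphi : R -> R) (r : R) :
  (forall s : R, is_derive s 1 phi (dphi s)) ->
  exists2 s, `|s| <= `|r| & phi r - phi 0 = dphi s * r.
Proof.
move=> dp.
have cp a b : {within `[a, b], continuous phi}.
  by apply: derivable_within_continuous => s _; have [] := dp s.
have [r0|/ltW r0] := leP 0 r.
  have [s] := MVT_segment r0 (fun s _ => dp s) (cp 0 r).
  rewrite in_itv /= => /andP[s0 sr] E; exists s; last by rewrite E subr0.
  by rewrite !ger0_norm.
have [s] := MVT_segment r0 (fun s _ => dp s) (cp r 0).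
rewrite in_itv /= => /andP[rs s0] E; exists s.
  by rewrite !ler0_norm // lerN2.
by rewrite -opprB E sub0r mulrN opprK.
Qed.

Lemma partialP f x i : C1 f -> is_derive x (unit_vec i) f (partial i f x).
Proof. by move=> [_ /(_ i) [d1 _]]; exact: derivableP. Qed.

(** The difference quotient along [v + c e_i] splits into the one along [v] and
    an increment of size [h c] in the direction [e_i]; the mean value theorem
    turns the latter into [c] times the i-th partial derivative at a point that
    tends to [x]. *)
Lemma is_derive_add_unit_vec f x v l c i : C1 f -> is_derive x v f l ->
  is_derive x (v + c *: unit_vec i) f (l + c * partial i f x).
Proof.
move=> f1 dfv.
suff cv : (fun h : R => h^-1 *: ((f \o shift x) (h *: (v + c *: unit_vec i)) - f x)) @ 0^'
     --> l + c * partial i f x.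
  by split; [apply/cvg_ex; eexists; exact: cv | exact: cvg_lim].
have E : (fun h : R => h^-1 *: ((f \o shift x) (h *: (v + c *: unit_vec i)) - f x)) =
   (fun h => h^-1 *: ((f \o shift x) (h *: v) - f x) +
        h^-1 * (f ((h * c) *: unit_vec i + (h *: v + x)) - f (h *: v + x))).
  apply/funext => h /=; rewrite -mulrDr; congr (_ * _).
  have -> : h *: (v + c *: unit_vec i) + x = (h * c) *: unit_vec i + (h *: v + x).
    by rewrite scalerDr scalerA addrCA addrA.
  ring.
rewrite E; apply: cvgD.
  have [d1 d2] := dfv; rewrite -d2; exact: d1.
have [_ /(_ i) [_ /(_ x) ci]] := f1.
apply/cvgrPdist_lt => e e0.
have ec : 0 < e / (`|c| + 1) by rewrite divr_gt0 // ltr_wpDl.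
move/cvgrPdist_lt : ci => /(_ _ ec) /nbhs_normP [del' /= del'0 Hci].
have vc : 0 < `|v| + `|c| * `|unit_vec i : 'rV[R]_d| + 1.
  by rewrite ltr_wpDl // addr_ge0 // mulr_ge0.
near=> h.
have hN0 : h != 0 by near: h; exact: nbhs_dnbhs_neq.
have [s|s sh] := @MVT_from0 (fun s => f (s *: unit_vec i + (h *: v + x)))
   (fun s => partial i f (s *: unit_vec i + (h *: v + x))) (h * c).
  by apply: is_derive_line; exact: partialP.
rewrite scale0r add0r => ->.
have -> : c * partial i f x - h^-1 * (partial i f (s *: unit_vec i + (h *: v + x)) * (h * c))
    = c * (partial i f x - partial i f (s *: unit_vec i + (h *: v + x))).
  by field.
rewrite normrM; apply: (@le_lt_trans _ _ (`|c| * (e / (`|c| + 1)))).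
  apply: ler_wpM2l => //; apply/ltW/Hci => /=.
  rewrite addrA opprD addrA addrAC subrr add0r normrN.
  apply: (@le_lt_trans _ _ (`|h| * (`|v| + `|c| * `|unit_vec i : 'rV[R]_d| + 1))).
    apply: (le_trans (ler_normD _ _)); rewrite !normrZ.
    have : `|s| * `|unit_vec i : 'rV[R]_d| <= `|h| * `|c| * `|unit_vec i : 'rV[R]_d|.
      by rewrite ler_wpM2r // -normrM.
    have := normr_ge0 h; lra.
  rewrite -ltr_pdivlMr //; near: h; apply: dnbhs0_lt; exact: divr_gt0.
rewrite mulrA -ltr_pdivlMr ?ltr_wpDl //.
have := normr_ge0 c; nra.
Unshelve. all: by end_near. Qed.

(** A direction is the sum of its components, so the directional derivative is
    reached by adding one coordinate at a time. *)
Lemma is_derive_C1 f x v : C1 f -> is_derive x v f (dotp (grad f x) v).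
Proof.
move=> f1; rewrite {1}(sum_unit_vec v) /dotp.
elim/big_rec2: _ => [|i w l _ IH]; first exact: is_derive0.
rewrite addrC (addrC (_ * _)) mulrC mxE; exact: is_derive_add_unit_vec.
Qed.

Lemma is_derive_C1_line f x v (h : R) : C1 f ->
  is_derive h 1 (fun s : R => f (s *: v + x)) (dotp (grad f (h *: v + x)) v).
Proof. by move=> f1; apply: is_derive_line; exact: is_derive_C1. Qed.


End C1Functions.

(** * Second-order conditions at a maximum *)

Section SecondOrderMaximum.
Context {R : realType} {d : nat}.
Implicit Types (F : 'rV[R]_d -> R) (x v : 'rV[R]_d).

(** Were the second derivative positive at 0, the first one, which vanishes
    there, would be positive just to the right, and the function would increase. *)
Lemma derive2_at_max (phi dphi : R -> R) (l : R) :
  (forall s : R, is_derive s 1 phi (dphi s)) -> is_derive (0 : R) 1 dphi l ->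
  (forall s, phi s <= phi 0) -> dphi 0 = 0 /\ l <= 0.
Proof.
move=> dp ddp mx.
have d0 : dphi 0 = 0.
  have l11 : (-1 : R) <= 1 by lra.
  have i0 : (0 : R) \in `](-1), 1[%R by rewrite in_itv /= ltrN10 ltr01.
  have dphi1 (s : R) : s \in `](-1), 1[%R -> derivable phi s 1 by have [] := dp s.
  have [_ E1] := derive1_at_max l11 dphi1 i0 (fun s _ => mx s).
  by have [_ E2] := dp 0; rewrite -E2 E1.
split => //; rewrite leNgt; apply/negP => l0.
have [d1 d2] := ddp.
have /cvgrPdist_lt /(_ _ l0) : (fun h : R => h^-1 *: ((dphi \o shift 0) (h *: 1) - dphi 0)) @ 0^' --> l.
  by rewrite -d2; exact: d1.
rewrite near_withinE => /nbhs_normP [e /= e0 He].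
have e20 : 0 < e / 2 by rewrite divr_gt0.
have [c] := MVT e20 (fun s _ => dp s)
   (derivable_within_continuous (fun s _ => @ex_derive _ _ _ _ _ _ _ (dp s))).
rewrite in_itv /= subr0 => /andP[c0 ce] E.
have := mx (e / 2); rewrite -subr_le0 E pmulr_lle0 // leNgt => /negP; apply.
have cN0 : c != 0 by rewrite gt_eqF.
have /He /(_ cN0) : ball_ Num.norm 0 e c.
  by rewrite /= sub0r normrN gtr0_norm //; apply: (lt_trans ce); rewrite ltr_pdivrMr // ltr_pMr // ltr1n.
rewrite /= addr0 d0 subr0 [c *: 1]mulr1 ltr_norml => /andP[_].
by rewrite ltrBlDl ltrDr pmulr_rgt0 // invr_gt0.
Qed.

Lemma grad_at_max F x : C1 F -> (forall y, F y <= F x) -> grad F x = 0.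
Proof.
move=> F1 mx; apply/rowP => i; rewrite -dotp_unit_vec [RHS]mxE.
have l11 : (-1 : R) <= 1 by lra.
have i0 : (0 : R) \in `](-1), 1[%R by rewrite in_itv /= ltrN10 ltr01.
have dF (s : R) := is_derive_C1_line x (unit_vec i) s F1.
have mx' (s : R) : s \in `](-1), 1[%R -> F (s *: unit_vec i + x) <= F (0 *: unit_vec i + x).
  by move=> _; rewrite scale0r add0r.
have [_ E1] := @derive1_at_max _ (fun s => F (s *: unit_vec i + x)) _ _ _ l11
  (fun s _ => @ex_derive _ _ _ _ _ _ _ (dF s)) i0 mx'.
by have [_] := dF 0; rewrite E1 scale0r add0r.
Qed.

(** Restriction to lines through the maximum point, along which the second
    derivative is the quadratic form of the Hessian. *)
Lemma grad_hess_at_max F x : C2 F -> (forall y, F y <= F x) ->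
  grad F x = 0 /\ forall v, quad_form (hess F x) v <= 0.
Proof.
move=> [F1 F2] mx.
have H v : dotp (grad F x) v = 0 /\ quad_form (hess F x) v <= 0.
  have := @derive2_at_max (fun s => F (s *: v + x))
    (fun s => dotp (grad F (s *: v + x)) v) (quad_form (hess F x) v)
    (fun s => is_derive_C1_line x v s F1).
  rewrite scale0r add0r; apply; last by [].
  have -> : (fun s : R => dotp (grad F (s *: v + x)) v) =
     \sum_(i < d) (fun s : R => (v 0 i *: (fun s => partial i F (s *: v + x))) s).
    apply/funext => s; rewrite fct_sumE; apply: eq_bigr => i _.
    by rewrite !mxE mulrC.
  have -> : quad_form (hess F x) v = \sum_(i < d) v 0 i * dotp (grad (partial i F) x) v.
    rewrite /quad_form {1}/dotp.
    under eq_bigr do rewrite !mxE mulr_suml.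
    rewrite exchange_big /=; apply: eq_bigr => i _.
    rewrite mulr_sumr; apply: eq_bigr => j _; rewrite !mxE; ring.
  apply: is_derive_sum => i; apply: is_deriveZ.
  have := is_derive_C1_line x v 0 (F2 i); by rewrite scale0r add0r.
split; last by move=> v; case: (H v).
apply/rowP => i; have [+ _] := H (unit_vec i).
by rewrite dotp_unit_vec => ->; rewrite mxE.
Qed.

Lemma quad_formE n (M : 'M[R]_n) xi : quad_form M xi = (xi *m M *m xi^T) 0 0.
Proof.
rewrite /quad_form /dotp -mulmxA !mxE; apply: eq_bigr => i _.
by rewrite !mxE mulrC.
Qed.

(** Lagrange reduction: with [a] the first diagonal entry, splitting off the
    square attached to the first row leaves the Schur complement of [a], which is
    again positive definite. *)
Lemma posdef_gram n (Q : 'M[R]_n) : Q^T = Q ->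
  (forall xi : 'rV[R]_n, xi != 0 -> 0 < quad_form Q xi) ->
  exists B : 'M[R]_n, Q = B^T *m B.
Proof.
elim: n Q => [|n IH]; first by move=> Q _ _; exists 0; apply/matrixP => -[].
rewrite -[n.+1]/(1 + n)%N => Q Qs Qp.
pose a := ulsubmx Q 0 0; pose r := ursubmx Q; pose S := drsubmx Q.
have QE : Q = block_mx a%:M r r^T S.
  rewrite -[LHS]submxK; congr block_mx; first exact: mx11_scalar.
  by rewrite /r -{1}Qs -trmx_ursub.
have a0 : 0 < a.
  have := Qp (row_mx 1%:M 0); rewrite quad_formE QE mul_row_block tr_row_mx mul_row_col.
  rewrite !mul0mx !addr0 trmx0 mulmx0 addr0 trmx1 mulmx1 mul1mx mxE eqxx mulr1n; apply.
  apply/eqP => /matrixP /(_ 0 (lshift n 0)); rewrite row_mxEl !mxE eqxx => /eqP.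
  by rewrite oner_eq0.
have [||B HB] := IH (S - a^-1 *: (r^T *m r)).
- rewrite linearB linearZ /= trmx_mul trmxK; congr (_ - _).
  by rewrite /S -[in RHS]Qs trmx_drsub.
- move=> xi xi0; pose k := (r *m xi^T) 0 0.
  (* the first coordinate is chosen so as to minimise the form of Q *)
  have := Qp (row_mx (- (k / a))%:M xi); rewrite !quad_formE QE mul_row_block tr_row_mx mul_row_col.
  have kE : r *m xi^T = k%:M by exact: mx11_scalar.
  have kE' : xi *m r^T = k%:M by rewrite -[LHS]trmxK trmx_mul trmxK kE tr_scalar_mx.
  rewrite kE' !mulmxDl -!mulmxA kE tr_scalar_mx -!scalar_mxM.
  rewrite mulmxBl mulmxBr -scalemxAl -scalemxAr -(mulmxA r^T) kE (mulmxA xi r^T) kE' -scalar_mxM.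
  rewrite !mxE !eqxx !mulr1n => H.
  have /H : row_mx (- (k / a))%:M xi != 0.
    by rewrite -row_mx0; apply: contra xi0 => /eqP /eq_row_mx [_ ->].
  set X := \sum_j _.
  suff -> : - (k / a) * (a * - (k / a)) + k * - (k / a) + (- (k / a) * k + X) = X - a^-1 * (k * k) by [].
  by field; rewrite gt_eqF.
exists (block_mx (Num.sqrt a)%:M ((Num.sqrt a)^-1 *: r) 0 B).
have sa : Num.sqrt a * Num.sqrt a = a by rewrite -expr2 sqr_sqrtr // ltW.
have sa0 : Num.sqrt a != 0 by rewrite gt_eqF // sqrtr_gt0.
rewrite [LHS]QE tr_block_mx mulmx_block trmx0 !mul0mx !mulmx0 !addr0 tr_scalar_mx -scalar_mxM sa.
have -> : ((Num.sqrt a)^-1 *: r)^T = (Num.sqrt a)^-1 *: r^T by exact: linearZ.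
rewrite -HB mul_mx_scalar mul_scalar_mx !scalerA mulfV // !scale1r.
by rewrite -scalemxAl -scalemxAr scalerA -invfM sa addrC subrK.
Qed.

(** Writing [Q] as a Gram matrix makes the trace a sum of values of the
    quadratic form of [H]. *)
Lemma trace_posdef_nsd (Q H : 'M[R]_d) : Q^T = Q ->
  (forall xi : 'rV[R]_d, xi != 0 -> 0 < quad_form Q xi) ->
  (forall xi, quad_form H xi <= 0) -> \tr (Q *m H) <= 0.
Proof.
move=> Qs Qp Hn; have [B ->] := posdef_gram Qs Qp.
rewrite -mulmxA mxtrace_mulC /mxtrace; apply: sumr_le0 => i _.
have := Hn (row i B); rewrite quad_formE tr_row colE !mulmxA -colE -!row_mul.
by rewrite mxE [X in X <= 0]mxE.
Qed.

End SecondOrderMaximum.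

(** * Calculus of C1 and C2 functions *)

Section CalculusC1C2.
Context {R : realType} {d : nat}.
Implicit Types (f g : 'rV[R]_d -> R) (x v a : 'rV[R]_d).

Lemma is_derive_lineP f x v l :
  is_derive (0 : R) 1 (fun s : R => f (s *: v + x)) l -> is_derive x v f l.
Proof.
have E : (fun k : R => k^-1 *: (((fun s : R => f (s *: v + x)) \o shift 0) (k *: 1) - f (0 *: v + x)))
   = (fun k : R => k^-1 *: ((f \o shift x) (k *: v) - f x)).
  by apply/funext => k /=; rewrite addr0 [k *: 1]mulr1 scale0r add0r.
by move=> [d1 d2]; split; [rewrite /derivable -E | rewrite /derive -E].
Qed.

Lemma is_derive_comp1 f (psi : R -> R) x v l m :
  is_derive x v f l -> is_derive (f x) 1 psi m ->
  is_derive x v (fun y => psi (f y)) (m * l).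
Proof.
move=> df dpsi; apply: is_derive_lineP.
have df' : is_derive (0 : R) 1 (fun s : R => f (s *: v + x)) l.
  by apply: is_derive_line; rewrite scale0r add0r.
have dpsi' : is_derive ((fun s : R => f (s *: v + x)) 0) 1 psi m.
  by rewrite scale0r add0r.
exact: (is_derive1_comp dpsi' df').
Qed.

(** Each C1 closure property below is stated as a pair: the function is C1, and its
    partial derivatives are given by equalities of functions. Second derivatives
    are then computed by applying the first-order rule to these functions. *)
Lemma C1_intro f (df : 'I_d -> 'rV[R]_d -> R) : continuous f ->
  (forall i x, is_derive x (unit_vec i) f (df i x)) -> (forall i, continuous (df i)) ->
  C1 f /\ forall i, partial i f = df i.
Proof.
move=> cf dfP cdf.
have E i : partial i f = df i by apply/funext => x; rewrite /partial; have [_ ->] := dfP i x.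
by split => //; split => // i; split => [x|]; [have [] := dfP i x | rewrite E].
Qed.

Lemma C1_cst c : C1 (fun _ : 'rV[R]_d => c) /\
  forall i, partial i (fun _ : 'rV[R]_d => c) = (fun=> 0).
Proof.
by apply: C1_intro => [|i]; exact: cst_continuous.
Qed.

Lemma C1D f g : C1 f -> C1 g -> C1 (fun x => f x + g x) /\
  forall i, partial i (fun x => f x + g x) = (fun x => partial i f x + partial i g x).
Proof.
move=> f1 g1; apply: C1_intro => [x|i x|i x].
- exact: cvgD (f1.1 x) (g1.1 x).
- by apply: is_deriveD; exact: partialP.
- exact: cvgD ((f1.2 i).2 x) ((g1.2 i).2 x).
Qed.

Lemma C1M f g : C1 f -> C1 g -> C1 (fun x => f x * g x) /\
  forall i, partial i (fun x => f x * g x) =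
            (fun x => f x * partial i g x + g x * partial i f x).
Proof.
move=> f1 g1.
have cf x := f1.1 x; have cg x := g1.1 x.
have cdf i x := (f1.2 i).2 x; have cdg i x := (g1.2 i).2 x.
apply: C1_intro => [x|i x|i x].
- exact: cvgM (cf x) (cg x).
- by apply: is_deriveM; exact: partialP.
- exact: cvgD (cvgM (cf x) (cdg i x)) (cvgM (cg x) (cdf i x)).
Qed.

Lemma C1Z c f : C1 f -> C1 (fun x => c * f x) /\
  forall i, partial i (fun x => c * f x) = (fun x => c * partial i f x).
Proof.
move=> f1; have [H E] := C1M (C1_cst c).1 f1; split => // i.
by rewrite E (C1_cst c).2; apply/funext => x; rewrite mulr0 addr0.
Qed.

Lemma C1_shift a f : C1 f -> C1 (fun x => f (x + a)) /\
  forall i, partial i (fun x => f (x + a)) = (fun x => partial i f (x + a)).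
Proof.
move=> f1.
have ca : continuous (fun x : 'rV[R]_d => x + a).
  by move=> x; exact: (cvgD cvg_id (cvg_cst _)).
apply: C1_intro => [x|i x|i x].
- exact: continuous_comp (ca x) (f1.1 _).
- apply: is_derive_lineP; under eq_fun do rewrite -addrA; apply: is_derive_line.
  by rewrite scale0r add0r; exact: partialP.
- exact: continuous_comp (ca x) ((f1.2 i).2 _).
Qed.

Lemma C1_comp f (psi dpsi : R -> R) : C1 f ->
  (forall x, is_derive (f x) 1 psi (dpsi (f x))) ->
  (forall x, {for f x, continuous dpsi}) ->
  C1 (fun x => psi (f x)) /\
  forall i, partial i (fun x => psi (f x)) = (fun x => dpsi (f x) * partial i f x).
Proof.
move=> f1 dP cP; apply: C1_intro => [x|i x|i x].
- apply: (continuous_comp (f1.1 x) _).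
  by apply/differentiable_continuous/derivable1_diffP; have [] := dP x.
- exact: is_derive_comp1 (partialP x i f1) (dP x).
- exact: cvgM (continuous_comp (f1.1 x) (cP x)) ((f1.2 i).2 x).
Qed.

Lemma gradE f (df : 'I_d -> 'rV[R]_d -> R) x :
  (forall i, partial i f = df i) -> grad f x = \row_i df i x.
Proof. by move=> E; apply/rowP => i; rewrite !mxE E. Qed.

Lemma C2_cst c : C2 (fun _ : 'rV[R]_d => c).
Proof. by split=> [|i]; [exact: (C1_cst c).1|rewrite (C1_cst c).2; exact: (C1_cst 0).1]. Qed.

Lemma C2D f g : C2 f -> C2 g -> C2 (fun x => f x + g x).
Proof.
move=> [f1 f2] [g1 g2]; have [fg1 fgE] := C1D f1 g1; split; first exact: fg1.
by move=> i; rewrite fgE; exact: (C1D (f2 i) (g2 i)).1.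
Qed.

Lemma C2Z c f : C2 f -> C2 (fun x => c * f x).
Proof.
move=> [f1 f2]; have [fg1 fgE] := C1Z c f1; split; first exact: fg1.
by move=> i; rewrite fgE; exact: (C1Z c (f2 i)).1.
Qed.

Lemma C2_shift a f : C2 f -> C2 (fun x => f (x + a)).
Proof.
move=> [f1 f2]; have [fg1 fgE] := C1_shift a f1; split; first exact: fg1.
by move=> i; rewrite fgE; exact: (C1_shift a (f2 i)).1.
Qed.

Lemma grad_cst c x : grad (fun _ : 'rV[R]_d => c) x = 0.
Proof. by apply/rowP => i; rewrite !mxE (C1_cst c).2. Qed.

Lemma gradD f g x : C1 f -> C1 g ->
  grad (fun x => f x + g x) x = grad f x + grad g x.
Proof. by move=> f1 g1; apply/rowP => i; rewrite !mxE (C1D f1 g1).2. Qed.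

Lemma gradZ c f x : C1 f -> grad (fun x => c * f x) x = c *: grad f x.
Proof. by move=> f1; apply/rowP => i; rewrite !mxE (C1Z c f1).2. Qed.

Lemma gradM f g x : C1 f -> C1 g ->
  grad (fun x => f x * g x) x = f x *: grad g x + g x *: grad f x.
Proof. by move=> f1 g1; apply/rowP => i; rewrite !mxE (C1M f1 g1).2. Qed.

Lemma hess_intro f (df : 'I_d -> 'rV[R]_d -> R) (ddf : 'I_d -> 'I_d -> 'rV[R]_d -> R) x :
  (forall j, partial j f = df j) -> (forall i j, partial i (df j) = ddf i j) ->
  hess f x = \matrix_(i, j) ddf i j x.
Proof. by move=> E1 E2; apply/matrixP => i j; rewrite !mxE E1 E2. Qed.

Lemma hess_cst c x : hess (fun _ : 'rV[R]_d => c) x = 0.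
Proof.
rewrite (hess_intro x (C1_cst c).2 (fun i _ => (C1_cst 0).2 i)).
by apply/matrixP => i j; rewrite [LHS]mxE [RHS]mxE ?mxE.
Qed.

Lemma hessD f g x : C2 f -> C2 g ->
  hess (fun x => f x + g x) x = hess f x + hess g x.
Proof.
move=> [f1 f2] [g1 g2].
rewrite (hess_intro x (C1D f1 g1).2 (fun i j => (C1D (f2 j) (g2 j)).2 i)).
by apply/matrixP => i j; rewrite [LHS]mxE [RHS]mxE; congr (_ + _); rewrite mxE.
Qed.

Lemma hessZ c f x : C2 f -> hess (fun x => c * f x) x = c *: hess f x.
Proof.
move=> [f1 f2].
rewrite (hess_intro x (C1Z c f1).2 (fun i j => (C1Z c (f2 j)).2 i)).
by apply/matrixP => i j; rewrite [LHS]mxE [RHS]mxE ?mxE.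
Qed.

Lemma hess_shift a f x : C2 f -> hess (fun x => f (x + a)) x = hess f (x + a).
Proof.
move=> [f1 f2].
rewrite (hess_intro x (C1_shift a f1).2 (fun i j => (C1_shift a (f2 j)).2 i)).
by apply/matrixP => i j; rewrite [LHS]mxE [RHS]mxE ?mxE.
Qed.

Section Operator.
Variables (Q : R -> 'M[R]_d) (b : R -> 'rV[R]_d -> 'rV[R]_d).

Lemma opA_cst t c x : opA Q b t (fun _ : 'rV[R]_d => c) x = 0.
Proof. by rewrite /opA hess_cst grad_cst mulmx0 mxtrace0 dotpC dotp0l addr0. Qed.

Lemma opAD t f g x : C2 f -> C2 g ->
  opA Q b t (fun x => f x + g x) x = opA Q b t f x + opA Q b t g x.
Proof.
move=> f2 g2; rewrite /opA hessD // gradD; [|exact: f2.1|exact: g2.1].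
by rewrite mulmxDr mxtraceD dotpDr addrACA.
Qed.

Lemma opAZ t c f x : C2 f -> opA Q b t (fun x => c * f x) x = c * opA Q b t f x.
Proof.
move=> f2; rewrite /opA hessZ // gradZ; last exact: f2.1.
by rewrite -scalemxAr mxtraceZ dotpZr mulrDr.
Qed.

End Operator.
End CalculusC1C2.

(** * Maximum principles *)

Section Topology.
Context {R : realType}.

Lemma within_continuous_comp_fun {X Y Z : topologicalType} (A : set X) (B : set Y)
    (g : X -> Y) (f : Y -> Z) :
  continuous g -> (forall x, A x -> B (g x)) -> {within B, continuous f} ->
  {within A, continuous (fun x => f (g x))}.
Proof.
move=> cg AB /subspace_continuousP cf; apply/subspace_continuousP => x Ax P /= Pf.
have H := cg x _ (cf (g x) (AB x Ax) P Pf).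
by apply: (@filterS _ (nbhs x) _ _ _ _ H) => y /= By /AB; exact: By.
Qed.

Lemma within_continuousM_fun {X : topologicalType} (A : set X) (f g : X -> R) :
  {within A, continuous f} -> {within A, continuous g} ->
  {within A, continuous (fun x => f x * g x)}.
Proof.
move=> /subspace_continuousP cf /subspace_continuousP cg.
by apply/subspace_continuousP => x Ax; exact: cvgM (cf x Ax) (cg x Ax).
Qed.

Lemma within_continuousD_fun {X : topologicalType} (A : set X) (f g : X -> R) :
  {within A, continuous f} -> {within A, continuous g} ->
  {within A, continuous (fun x => f x + g x)}.
Proof. exact: within_continuousD. Qed.

(** Only the past of [t] is compared: on a time interval [s, T] the maximum may
    sit at the final time, where no two-sided condition is available. *)
Lemma derive_left_max (f : R -> R) (s t : R) : s < t -> derivable f t 1 ->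
  (forall r, s <= r <= t -> f r <= f t) -> 0 <= derive1 f t.
Proof.
move=> st df mx; rewrite derive1E ['D_1 f t]cvg_at_leftE; last exact: df.
apply: limr_ge.
  rewrite -(cvg_at_leftE (fun h => h^-1 *: ((f \o shift t) _ - f t))) //.
  apply: cvg_trans df; apply: cvg_app.
  move=> A [e egt0 Ae]; exists e => // x xe xgt0; apply: Ae => //.
  exact/ltr0_neq0.
near=> h; have h0 : h < 0 by near: h; exact: nbhs_left_lt.
apply: mulr_le0; first by rewrite invr_le0 ltW.
rewrite subr_le0 [_%:A]mulr1; apply: mx => /=.
rewrite -lerBlDr gerDr (ltW h0) andbT ltW //; near: h; apply: nbhs_left_gt.
by rewrite subr_lt0.
Unshelve. all: by end_near. Qed.

Lemma is_derive_affine (c s t : R) : is_derive t 1 (fun t => c * (t - s)) c.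
Proof.
have -> : (fun t => c * (t - s)) = (c *: (@id R - cst s)) by apply/funext => z.
by apply: is_derive_eq; rewrite subr0 [_ *: _]mulr1.
Qed.

End Topology.

Lemma C1_sqdist {R : realType} {d : nat} (x : 'rV[R]_d) :
  C1 (fun y => dotp (y - x) (y - x)) /\
  forall y, grad (fun y => dotp (y - x) (y - x)) y = 2 *: (y - x).
Proof.
have cw i : continuous (fun y : 'rV[R]_d => (y - x) 0 i).
  have -> : (fun y : 'rV[R]_d => (y - x) 0 i) = (fun y => y 0 i - x 0 i).
    by apply/funext => z; rewrite !mxE.
  move=> y; exact: (cvgB (@coord_continuous _ _ _ 0 i y) (cvg_cst _)).
have cc i : continuous (fun y : 'rV[R]_d => 2 * (y - x) 0 i).
  by move=> y; exact: (cvgM (cvg_cst _) (cw i y)).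
have [|i y|//|q1 qE] := @C1_intro R d (fun y => dotp (y - x) (y - x)) (fun i y => 2 * (y - x) 0 i).
- by move=> y; apply: (@cvg_sumr _ _ _ (nbhs y) _) => i; exact: (cvgM (cw i y) (cw i y)).
- apply: is_derive_lineP.
  have -> : (fun s : R => dotp (s *: unit_vec i + y - x) (s *: unit_vec i + y - x)) =
      (fun s => dotp (s *: unit_vec i + (y - x)) (s *: unit_vec i + (y - x))).
    by apply/funext => s; rewrite -addrA.
  move: (y - x) => w.
  have -> : (fun s : R => dotp (s *: unit_vec i + w) (s *: unit_vec i + w)) =
      (fun s => dotp w w + s * (2 * w 0 i + s)).
    apply/funext => s; rewrite !(dotpDl, dotpDr, dotpZl, dotpZr) !dotp_unit_vec.
    rewrite (dotpC (unit_vec i) w) dotp_unit_vec mxE !eqxx /=; ring.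
  have di : is_derive (0 : R) 1 (@id R) 1 by exact: is_derive_id.
  have dc (k : R) : is_derive (0 : R) 1 (cst k) 0 by exact: is_derive_cst.
  have := is_deriveD (dc (dotp w w)) (is_deriveM di (is_deriveD (dc (2 * w 0 i)) di)).
  move=> /(@is_derive_eq _ _ _ _ _ _ (2 * w 0 i)); apply.
  by rewrite /GRing.scale /= -[(_ + id) 0]/(2 * w 0 i + 0) addr0 mul0r !add0r mulr1.
split => // y; rewrite (gradE y qE).
by apply/rowP => i; rewrite !mxE.
Qed.

Section MaximumPrinciple.
Context {R : realType} {d : nat}.
Variables (Q : R -> 'M[R]_d) (b : R -> 'rV[R]_d -> 'rV[R]_d).
Implicit Types (F U P S : R -> 'rV[R]_d -> R) (f phi : 'rV[R]_d -> R) (s t : R).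
Notation opA := (opA Q b).

Definition heat F (t : R) (x : 'rV[R]_d) : R := Dt F t x - opA t (F t) x.

(** What the maximum principles need from a function on [[s, +oo) x R^d]: continuity
    up to the initial time, and enough derivatives afterwards for [heat]. *)
Record classical s F : Prop := Classical {
  classical_continuous : {within `[s, +oo[%classic `*` setT,
    continuous (fun y : R * 'rV[R]_d => F y.1 y.2)} ;
  classical_C2 : forall t, s < t -> C2 (F t) ;
  classical_derivable : forall t x, s < t -> derivable (fun r => F r x) t 1 }.

Lemma continuous_snd_comp s f : continuous f ->
  {within `[s, +oo[%classic `*` setT, continuous (fun y : R * 'rV[R]_d => f y.2)}.
Proof.
move=> cf; apply: continuous_subspaceT => y.
by apply: (@continuous_comp _ _ _ snd f y); [exact: cvg_snd|exact: cf].
Qed.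

Lemma classical_space s f : C2 f -> classical s (fun _ => f) /\
  forall t x, heat (fun _ => f) t x = - opA t f x.
Proof.
move=> f2; split.
  split => //; first exact: continuous_snd_comp f2.1.1.
by move=> t x; rewrite /heat /Dt derive1_cst sub0r.
Qed.

Lemma classicalD s F U : classical s F -> classical s U ->
  classical s (fun t x => F t x + U t x) /\
  forall t x, s < t -> heat (fun t x => F t x + U t x) t x = heat F t x + heat U t x.
Proof.
move=> [cF F2 dF] [cU U2 dU]; split.
  split => [|t st|t x st]; first exact: within_continuousD_fun.
  - by apply: C2D; [exact: F2|exact: U2].
  - by apply: derivableD; [exact: dF|exact: dU].
move=> t x st; rewrite /heat opAD; [|exact: F2|exact: U2].
rewrite /Dt !derive1E (@deriveD _ _ _ (fun r => F r x) (fun r => U r x)); [ring|exact: dF|exact: dU].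
Qed.

Lemma classicalMt s (m dm : R -> R) F : (forall t : R, is_derive t 1 m (dm t)) ->
  classical s F ->
  classical s (fun t x => m t * F t x) /\
  forall t x, s < t -> heat (fun t x => m t * F t x) t x = m t * heat F t x + dm t * F t x.
Proof.
move=> dmP [cF F2 dF].
have cm : continuous m.
  by move=> t; apply/differentiable_continuous/derivable1_diffP; have [] := dmP t.
split.
  split => [|t st|t x st].
  - apply: within_continuousM_fun => //; apply: continuous_subspaceT => y.
    by apply: (@continuous_comp _ _ _ fst m y); [exact: cvg_fst|exact: cm].
  - by apply: C2Z; exact: F2.
  - by apply: derivableM; [have [] := dmP t|exact: dF].
move=> t x st; rewrite /heat opAZ; last exact: F2.
rewrite /Dt !derive1E (@deriveM _ _ m (fun r => F r x)); [|by have [] := dmP t|exact: dF].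
have [_ ->] := dmP t; rewrite /= /GRing.scale /=; ring.
Qed.

Lemma sublevel_compact phi M : continuous phi ->
  (forall M, exists r, forall x, r <= enorm x -> M <= phi x) ->
  compact [set x | phi x <= M].
Proof.
move=> cphi phi_coercive; have [r Hr] := phi_coercive (M + 1).
apply: bounded_closed_compact.
  exists r; split; first exact: num_real.
  move=> r' rr' x /= xM; apply: (le_trans (le_norm_enorm x)); rewrite leNgt.
  by apply/negP => /ltW r'x; have := Hr _ (le_trans (ltW rr') r'x); lra.
apply: (@preimage_closed _ _ phi [set x | x <= M]); last exact: closed_le.
by move=> x _; exact: cphi.
Qed.

(** The data in the form used by the maximum principles: dissipativity of the drift
    in its integrated form, and the Lyapunov bound weakened to [A(t) phi <= a]. *)
Record dissipative_setting (I : set R) (phi : 'rV[R]_d -> R) (a r0 : R) : Prop := {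
  setting_upper : forall s t, I s -> s <= t -> I t ;
  setting_sym : forall t, I t -> (Q t)^T = Q t ;
  setting_posdef : forall t, I t -> forall xi : 'rV[R]_d, xi != 0 -> 0 < quad_form (Q t) xi ;
  setting_drift : forall t x y, I t ->
    dotp (b t y - b t x) (y - x) <= r0 * dotp (y - x) (y - x) ;
  setting_C2 : C2 phi ;
  setting_pos : forall x, 0 < phi x ;
  setting_coercive : forall M, exists r, forall x, r <= enorm x -> M <= phi x ;
  setting_a_gt0 : 0 < a ;
  setting_opA : forall t x, I t -> opA t phi x <= a }.

Section Comparison.
Variables (I : set R) (phi : 'rV[R]_d -> R) (a r0 : R).
Hypothesis setting : dissipative_setting I phi a r0.

Let Iup := setting_upper setting.
Let Qsym := setting_sym setting.
Let Qpos := setting_posdef setting.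
Let bdiss := setting_drift setting.
Let phi2 := setting_C2 setting.
Let phi0 := setting_pos setting.
Let a0 := setting_a_gt0 setting.
Let phiA := setting_opA setting.
Let phiK M := sublevel_compact (M := M) phi2.1.1 (setting_coercive setting).

Lemma opA_at_max t f x : I t -> C2 f -> (forall y, f y <= f x) -> opA t f x <= 0.
Proof.
move=> It f2 mx; have [g0 hn] := grad_hess_at_max f2 mx.
rewrite /opA g0 dotpC dotp0l addr0; apply: trace_posdef_nsd hn; first exact: Qsym.
exact: Qpos.
Qed.

(** The Lyapunov function with a drift in time is a supersolution as soon as
    [c >= a]; it confines maximum points to a compact set. *)
Lemma penalty_classical s c : classical s (fun t x => phi x + c * (t - s)) /\
  forall t x, s < t -> I t -> c - a <= heat (fun t x => phi x + c * (t - s)) t x.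
Proof.
have dm := is_derive_affine c s.
have [H1 H2] := classical_space s phi2.
have [H3 H4] := classical_space s (C2_cst 1).
have [H5 H6] := classicalMt dm H3; have [H7 H8] := classicalD H1 H5.
have E : (fun t x => phi x + c * (t - s) * 1) = (fun t x => phi x + c * (t - s)).
  by apply/funext => t; apply/funext => x; rewrite mulr1.
rewrite E in H7 H8; split => // t x st It.
rewrite H8 // H2 H6 // H4 opA_cst oppr0 mulr0 add0r mulr1.
by have := phiA x It; lra.
Qed.

(** Subtracting a small multiple of [phi + (a + 1)(t - s)] makes a positive value
    attained at a maximum point after time [s], where [heat] is nonnegative by the
    first and second order conditions but negative by construction. *)
Lemma comparison s F M : I s -> classical s F ->
  (forall t x, s <= t -> F t x <= M) -> (forall x, F s x <= 0) ->
  (forall t x, s < t -> heat F t x <= 0) ->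
  forall t x, s <= t -> F t x <= 0.
Proof.
move=> Is Fc FM Fs Fh T x0 sT; rewrite leNgt; apply/negP => Fpos.
pose psi (t : R) x := phi x + (a + 1) * (t - s).
have psi0 : 0 < psi T x0.
  by rewrite /psi ltr_wpDr // mulr_ge0 ?subr_ge0 // addr_ge0 // ltW.
(* small enough for half of F(T, x0) to survive the subtraction *)
pose eta := F T x0 / (2 * psi T x0).
have eta0 : 0 < eta by rewrite divr_gt0 // mulr_gt0.
have [psic psih] := penalty_classical s (a + 1).
have dc (t : R) : is_derive t 1 (fun=> - eta) 0 by exact: is_derive_cst.
have [epsic epsih] := classicalMt dc psic.
pose Phi t x := F t x + - eta * psi t x.
have [Phic Phih] : classical s Phi /\ forall t x, s < t ->
  heat Phi t x = heat F t x + heat (fun t x => - eta * psi t x) t x := classicalD Fc epsic.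
have PhiT : 0 < Phi T x0.
  have E : eta * psi T x0 = F T x0 / 2 by rewrite /eta; field; rewrite gt_eqF.
  rewrite /Phi mulNr E; lra.
have Phiout t x : s <= t -> M / eta < phi x -> Phi t x < 0.
  move=> st; rewrite ltr_pdivrMr // => H; rewrite /Phi /psi.
  have := FM t x st; have : 0 <= eta * ((a + 1) * (t - s)).
    by rewrite mulr_ge0 ?(ltW eta0) // mulr_ge0 ?subr_ge0 // addr_ge0 // ltW.
  lra.
pose A : set (R * 'rV[R]_d) := `[s, T]%classic `*` [set x | phi x <= M / eta].
have Ax0 : A (T, x0).
  split; first by rewrite /= in_itv /= sT lexx.
  by rewrite /= leNgt; apply/negP => /(Phiout T x0 sT); rewrite ltNge (ltW PhiT).
have [||[t x]] := @compact_EVT_max _ _ (fun y => Phi y.1 y.2) A (ex_intro _ _ Ax0).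
- by apply: compact_setX; [exact: segment_compact|exact: phiK].
- apply: (continuous_subspaceW _ (classical_continuous Phic)).
  by move=> [t x] [] /=; rewrite !in_itv /= => /andP[-> _].
rewrite inE => -[/=]; rewrite in_itv /= => /andP[st tT] xK mx.
have Phip : 0 < Phi t x by apply: (lt_le_trans PhiT); apply: (mx (T, x0)); rewrite inE.
have {}st : s < t.
  rewrite lt_neqAle st andbT; apply/eqP => E; move: Phip; rewrite -E /Phi /psi subrr mulr0 addr0.
  by rewrite ltNge => /negP; apply; have := Fs x; have := mulr_gt0 eta0 (phi0 x); lra.
have It : I t by exact: Iup Is (ltW st).
have mxx y : Phi t y <= Phi t x.
  have [yK|/(Phiout t y (ltW st)) /ltW yK] := leP (phi y) (M / eta).
    by apply: (mx (t, y)); rewrite inE; split => //=; rewrite in_itv /= tT ltW.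
  exact: le_trans yK (ltW Phip).
have A0 : opA t (Phi t) x <= 0 by exact: (opA_at_max It (classical_C2 Phic st) mxx).
have D0 : 0 <= Dt Phi t x.
  apply: (@derive_left_max _ (fun r => Phi r x) s t st (classical_derivable Phic st)).
  move=> r /andP[sr rt]; apply: (mx (r, x)); rewrite inE; split => //=.
  by rewrite in_itv /= sr (le_trans rt).
have : 0 <= heat Phi t x by rewrite /heat subr_ge0 (le_trans A0).
rewrite Phih // epsih // mul0r addr0.
have := Fh t x st; have := psih t x st It; rewrite -/psi => H1 H2.
have : eta * 1 <= eta * heat psi t x by apply: ler_wpM2l; [exact: ltW|lra].
lra.
Qed.

Lemma coupling_arith (rho r T1 T2 T3 D1 D2 D3 B2 B3 c1 c2 sg : R) :
  T1 - T2 - rho * T3 <= 0 -> 0 <= D1 - D2 - rho * D3 ->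
  2 * sg * (c2 - c1) <= 2 * sg * (r * rho) -> B2 + rho * B3 = 2 * sg * c1 ->
  0 <= (D1 - (T1 + 2 * sg * c2)) - (D2 - (T2 + B2)) - rho * (D3 - (T3 + B3) - 2 * r * sg).
Proof. by move=> h1 h2 h3 h4; lra. Qed.

(** The heart of the proof: synchronous coupling. As [Q] depends on time only, the
    second-order condition is used only along the diagonal [z -> (x + z, y + z)],
    on which [|y - x|^2] is constant; the two points are thus driven by the same
    noise, and only second derivatives of [U], [P] and [S] appear. The first-order
    conditions in [x] and in [y] leave the drift term
    [2 S <b(y) - b(x), y - x>], controlled by dissipativity. *)
Lemma coupling_at_max s U P S t x y : I t -> s < t ->
  classical s U -> classical s P -> classical s S -> 0 <= S t x ->
  let Phi r x y := U r y - P r x - dotp (y - x) (y - x) * S r x in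
  (forall x' y', Phi t x' y' <= Phi t x y) ->
  (forall r, s <= r <= t -> Phi r x y <= Phi t x y) ->
  0 <= heat U t y - heat P t x - dotp (y - x) (y - x) * (heat S t x - 2 * r0 * S t x).
Proof.
move=> It st Uc Pc Sc S0 Phi mx mxt.
have U2 := classical_C2 Uc st; have P2 := classical_C2 Pc st; have S2 := classical_C2 Sc st.
set rho := dotp (y - x) (y - x).
have gU : grad (U t) y = (2 * S t x) *: (y - x).
  pose q := fun y' : 'rV[R]_d => dotp (y' - x) (y' - x).
  have [q1 gq] := C1_sqdist x.
  have q1' : C1 (fun y' => - S t x * q y') by exact: (C1Z _ q1).1.
  have H : C1 (fun y' => U t y' + - S t x * q y') by exact: (C1D U2.1 q1').1.
  have : grad (fun y' => U t y' + - S t x * q y') y = 0.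
    by apply: (grad_at_max H) => y'; have := mx x y'; rewrite /Phi /q; lra.
  rewrite (gradD _ U2.1 q1') (gradZ _ _ q1) gq => /eqP; rewrite addr_eq0 => /eqP ->.
  by rewrite scaleNr opprK scalerA (mulrC 2).
have gPS : grad (P t) x + rho *: grad (S t) x = (2 * S t x) *: (y - x).
  pose q := fun x' : 'rV[R]_d => dotp (x' - y) (x' - y).
  have [q1 gq] := C1_sqdist y.
  have H1 : C1 (fun x' => q x' * S t x') by exact: (C1M q1 S2.1).1.
  have H2 : C1 (fun x' => P t x' + q x' * S t x') by exact: (C1D P2.1 H1).1.
  have H : C1 (fun x' => -1 * (P t x' + q x' * S t x')) by exact: (C1Z (-1) H2).1.
  have qE x' : q x' = dotp (y - x') (y - x') by rewrite /q -opprB dotpNl dotpNr opprK.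
  have E : grad (fun x' => -1 * (P t x' + q x' * S t x')) x = 0.
    by apply: (grad_at_max H) => x'; have := mx x' y; rewrite /Phi !qE; lra.
  rewrite (gradZ _ _ H2) (gradD _ P2.1 H1) (gradM _ q1 S2.1) gq in E.
  have qx : dotp (x - y) (x - y) = rho by exact: qE.
  move: E; rewrite qx scaleN1r => /eqP; rewrite oppr_eq0 addrA addr_eq0 => /eqP ->.
  by rewrite scalerA -scalerN opprB (mulrC 2).
(* moving both points by the same z leaves |y - x| unchanged *)
have trQ : \tr (Q t *m hess (U t) y) - \tr (Q t *m hess (P t) x)
    - rho * \tr (Q t *m hess (S t) x) <= 0.
  have Us := C2_shift y U2; have Ps := C2_shift x P2; have Ss := C2_shift x S2.
  have PSs := C2D Ps (C2Z rho Ss); have nPSs := C2Z (-1) PSs.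
  have [] := @grad_hess_at_max _ _ _ 0 (C2D Us nPSs).
    move=> z; have := mx (z + x) (z + y); rewrite /Phi !add0r.
    by rewrite (_ : z + y - (z + x) = y - x) -/rho; [lra|rewrite opprD addrACA subrr add0r].
  rewrite (hessD _ Us nPSs) (hessZ _ _ PSs) (hessD _ Ps (C2Z rho Ss)) (hessZ _ _ Ss).
  rewrite !hess_shift // !add0r => _ hn.
  have := trace_posdef_nsd (Qsym It) (Qpos It) hn.
  rewrite scaleN1r mulmxDr mxtraceD mulmxN raddfN /= mulmxDr mxtraceD -scalemxAr mxtraceZ.
  by rewrite opprD addrA.
have D0 : 0 <= Dt U t y - Dt P t x - rho * Dt S t x.
  have dU := classical_derivable Uc (x := y) st.
  have dP := classical_derivable Pc (x := x) st.
  have dS := classical_derivable Sc (x := x) st.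
  have dPhi : is_derive t 1 (fun r => Phi r x y) (Dt U t y - Dt P t x - rho * Dt S t x).
    have -> : (fun r => Phi r x y) = (fun r => U r y) - (fun r => P r x) - (rho *: (fun r => S r x)) by [].
    rewrite /Dt !derive1E.
    exact: (is_deriveB (is_deriveB (derivableP dU) (derivableP dP)) (is_deriveZ rho (derivableP dS))).
  have := @derive_left_max _ (fun r => Phi r x y) s t st _ mxt.
  by rewrite derive1E; have [d1 ->] := dPhi; apply.
have bd : 2 * S t x * dotp (b t y - b t x) (y - x) <= 2 * S t x * (r0 * rho).
  by apply: ler_wpM2l; [rewrite mulr_ge0|exact: bdiss].
have E : dotp (b t x) (grad (P t) x) + rho * dotp (b t x) (grad (S t) x)
   = 2 * S t x * dotp (b t x) (y - x) by rewrite -dotpZr -dotpDr gPS dotpZr.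
rewrite dotpDl dotpNl in bd.
rewrite /heat /Defs.opA gU dotpZr; exact: coupling_arith trQ D0 bd E.
Qed.

Lemma coupling_final_arith (eta c u1 u2 u3 u4 u5 : R) : 0 < eta ->
  eta * (c - c) <= eta * u3 -> eta * (c + 1 - c) <= eta * u4 -> u1 <= 0 -> 0 <= u2 -> 0 <= u5 ->
  (u1 + - eta * u3) - (u2 + eta * u4) - u5 < 0.
Proof. by move=> *; lra. Qed.

(** A maximum principle for [U(t, y) - P(t, x) - |y - x|^2 S(t, x)] on the doubled
    space, which bounds increments of [U] without differentiating its equation.
    The rate [2 r0] in the condition on [S] is the contraction rate of the squared
    distance between two synchronously coupled points. *)
Lemma coupling_comparison s U P S MU MP : I s ->
  classical s U -> classical s P -> classical s S ->
  (forall t x, s <= t -> U t x <= MU) -> (forall t x, s <= t -> MP <= P t x) ->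
  (forall t x, s <= t -> 0 <= S t x) ->
  (forall x y, U s y <= P s x + dotp (y - x) (y - x) * S s x) ->
  (forall t x, s < t -> heat U t x <= 0) -> (forall t x, s < t -> 0 <= heat P t x) ->
  (forall t x, s < t -> 2 * r0 * S t x <= heat S t x) ->
  forall t x y, s <= t -> U t y <= P t x + dotp (y - x) (y - x) * S t x.
Proof.
move=> Is Uc Pc Sc UM PM S0 ini hU hP hS T x0 y0 sT; rewrite leNgt; apply/negP => pos0.
pose psi c (t : R) x := phi x + c * (t - s).
(* the slope a makes the penalty on y a supersolution; the extra 1 on the side
   of x makes the final inequality strict *)
pose pen := psi a T y0 + psi (a + 1) T x0.
have pen0 : 0 < pen.
  by rewrite /pen /psi addr_gt0 // ltr_wpDr // mulr_ge0 ?subr_ge0 // ?addr_ge0 // ltW.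
set D0 := P T x0 + _ in pos0.
pose eta := (U T y0 - D0) / (2 * pen).
have eta0 : 0 < eta by rewrite divr_gt0 ?subr_gt0 // mulr_gt0.
have [psi1c psi1h] : classical s (psi a) /\ forall t x, s < t -> I t ->
  a - a <= heat (psi a) t x := penalty_classical s a.
have [psi2c psi2h] : classical s (psi (a + 1)) /\ forall t x, s < t -> I t ->
  a + 1 - a <= heat (psi (a + 1)) t x := penalty_classical s (a + 1).
have dc (c t : R) : is_derive t 1 (fun=> c) 0 by exact: is_derive_cst.
pose U' t y := U t y + - eta * psi a t y.
pose P' t x := P t x + eta * psi (a + 1) t x.
have [epsi1c epsi1h] := classicalMt (dc (- eta)) psi1c.
have [epsi2c epsi2h] := classicalMt (dc eta) psi2c.
have [U'c U'h] : classical s U' /\ forall t x, s < t ->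
  heat U' t x = heat U t x + heat (fun t x => - eta * psi a t x) t x := classicalD Uc epsi1c.
have [P'c P'h] : classical s P' /\ forall t x, s < t ->
  heat P' t x = heat P t x + heat (fun t x => eta * psi (a + 1) t x) t x := classicalD Pc epsi2c.
pose Phi r x y := U' r y - P' r x - dotp (y - x) (y - x) * S r x.
have psi_ge c t x : 0 < c -> s <= t -> phi x <= psi c t x.
  by move=> c0 st; rewrite lerDl mulr_ge0 ?subr_ge0 // ltW.
have PhiT : 0 < Phi T x0 y0.
  have -> : Phi T x0 y0 = (U T y0 - D0) - eta * pen by rewrite /Phi /U' /P' /D0 /pen; ring.
  have -> : eta * pen = (U T y0 - D0) / 2 by rewrite /eta; field; rewrite gt_eqF.
  by rewrite subr_gt0 ltr_pdivrMr // ltr_pMr ?subr_gt0 // ltr1n.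
have a10 : 0 < a + 1 by rewrite addr_gt0.
have Phiout t x y : s <= t -> MU - MP < eta * (phi x + phi y) -> Phi t x y < 0.
  move=> st H; have h1 := UM t y st; have h2 := PM t x st.
  have h3 : 0 <= dotp (y - x) (y - x) * S t x by rewrite mulr_ge0 ?dotpxx_ge0 // S0.
  have h4 : eta * phi y <= eta * psi a t y by rewrite ler_wpM2l ?psi_ge // ltW.
  have h5 : eta * phi x <= eta * psi (a + 1) t x by rewrite ler_wpM2l ?psi_ge // ltW.
  rewrite /Phi /U' /P' mulNr; move: H; rewrite mulrDr; clear -h1 h2 h3 h4 h5; lra.
pose L := (MU - MP) / eta.
pose K := [set x | phi x <= L].
have Kout t x y : s <= t -> L < phi x \/ L < phi y -> Phi t x y < 0.
  move=> st H; apply: (Phiout _ _ _ st); rewrite -ltr_pdivrMl // mulrC -/L.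
  by have := phi0 x; have := phi0 y; case: H => H; lra.
pose A : set (R * ('rV[R]_d * 'rV[R]_d)) := `[s, T]%classic `*` (K `*` K).
have AP t x y : s <= t -> t <= T -> Phi t x y <= 0 \/ A (t, (x, y)).
  move=> st tT; have [xK|/or_introl xK] := leP (phi x) L; last first.
    by left; apply/ltW/(Kout _ _ _ st)/xK.
  have [yK|/or_intror yK] := leP (phi y) L; last first.
    by left; apply/ltW/(Kout _ _ _ st)/yK.
  by right; split; [rewrite /= in_itv /= st tT|split].
have A0 : A (T, (x0, y0)) by case: (AP T x0 y0 sT (lexx T)) => //; rewrite leNgt PhiT.
have [||[t [x y]]] := @compact_EVT_max _ _ (fun z => Phi z.1 z.2.1 z.2.2) A (ex_intro _ _ A0).
- apply: compact_setX; first exact: segment_compact.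
  by apply: compact_setX; exact: phiK.
- pose X : topologicalType := (R * ('rV[R]_d * 'rV[R]_d))%type.
  have c21 : continuous (fun z : X => z.2.1).
    by move=> z; apply: (@continuous_comp _ _ _ snd fst z); [exact: cvg_snd|exact: cvg_fst].
  have c22 : continuous (fun z : X => z.2.2).
    by move=> z; apply: (@continuous_comp _ _ _ snd snd z); [exact: cvg_snd|exact: cvg_snd].
  have c1 : continuous (fun z : X => (z.1, z.2.1)).
    by move=> z; exact: cvg_pair cvg_fst (c21 z).
  have c2 : continuous (fun z : X => (z.1, z.2.2)).
    by move=> z; exact: cvg_pair cvg_fst (c22 z).
  have A1 z : A z -> (`[s, +oo[%classic `*` [set: 'rV[R]_d]) (z.1, z.2.1).
    by case: z => t [x y] [] /=; rewrite !in_itv /= => /andP[-> _].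
  have A2 z : A z -> (`[s, +oo[%classic `*` [set: 'rV[R]_d]) (z.1, z.2.2).
    by case: z => t [x y] [] /=; rewrite !in_itv /= => /andP[-> _].
  have cU := within_continuous_comp_fun c2 A2 (classical_continuous U'c).
  have cP := within_continuous_comp_fun c1 A1 (classical_continuous P'c).
  have cS := within_continuous_comp_fun c1 A1 (classical_continuous Sc).
  have cq : continuous (fun z : X => - dotp (z.2.2 - z.2.1) (z.2.2 - z.2.1)).
    move=> z; apply: cvgN.
    apply: (@continuous_comp _ _ _ (fun z : X => z.2.2 - z.2.1) (fun w => dotp w w) z).
      exact: (cvgB (c22 z) (c21 z)).
    have [[cd _] _] := @C1_sqdist R d 0; have := cd (z.2.2 - z.2.1).
    by rewrite (_ : (fun y => dotp (y - 0) (y - 0)) = (fun y => dotp y y)) //; apply/funext => w; rewrite subr0.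
  have cm : continuous (fun _ : X => (-1 : R)) by exact: cst_continuous.
  have := within_continuousD_fun (within_continuousD_fun cU
    (within_continuousM_fun (continuous_subspaceT cm) cP))
    (within_continuousM_fun (continuous_subspaceT cq) cS).
  rewrite (_ : (fun z => _ + _) = (fun z : X => Phi z.1 z.2.1 z.2.2)) //.
  by apply/funext => z; rewrite /Phi /= mulN1r mulNr.
rewrite inE => Atxy mx.
have [+ _] := Atxy; rewrite /= in_itv /= => /andP[st tT].
have Phip : 0 < Phi t x y by apply: (lt_le_trans PhiT); apply: (mx (T, (x0, y0))); rewrite inE.
have {}st : s < t.
  rewrite lt_neqAle st andbT; apply/eqP => E; move: Phip; rewrite -E ltNge => /negP; apply.
  have h1 := ini x y; have h2 := mulr_gt0 eta0 (phi0 x); have h3 := mulr_gt0 eta0 (phi0 y).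
  by rewrite /Phi /U' /P' /psi subrr !mulr0 !addr0 mulNr; clear -h1 h2 h3; lra.
have It : I t by exact: Iup Is (ltW st).
have mxx x' y' : Phi t x' y' <= Phi t x y.
  case: (AP t x' y' (ltW st) tT) => [h|h]; first exact: le_trans h (ltW Phip).
  by apply: (mx (t, (x', y'))); rewrite inE.
have mxt r : s <= r <= t -> Phi r x y <= Phi t x y.
  move=> /andP[sr rt]; case: (AP r x y sr (le_trans rt tT)) => [h|h].
    exact: le_trans h (ltW Phip).
  by apply: (mx (r, (x, y))); rewrite inE.
apply/negP : (coupling_at_max It st U'c P'c Sc (S0 t x (ltW st)) mxx mxt).
rewrite U'h // P'h // epsi1h // epsi2h // !mul0r !addr0.
have h1 : eta * (a - a) <= eta * heat (psi a) t y by rewrite ler_wpM2l ?psi1h // ltW.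
have h2 : eta * (a + 1 - a) <= eta * heat (psi (a + 1)) t x by rewrite ler_wpM2l ?psi2h // ltW.
have h3 := hU t y st; have h4 := hP t x st.
have h5 : 0 <= dotp (y - x) (y - x) * (heat S t x - 2 * r0 * S t x).
  by rewrite mulr_ge0 ?dotpxx_ge0 // subr_ge0 hS.
by rewrite -ltNge; exact: coupling_final_arith eta0 h1 h2 h3 h4 h5.
Qed.

End Comparison.
End MaximumPrinciple.

(** * Powers, entropy and bounded continuous functions *)

Section ScalarFunctions.
Context {R : realType}.

Lemma bounded_realP {T : Type} (A : set T) (f : T -> R) :
  [bounded f x | x in A] <-> exists M, forall x, A x -> `|f x| <= M.
Proof.
split=> [[M [_ HM]]|[M HM]].
  by exists (M + 1) => x Ax; apply: HM => //; rewrite ltrDl.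
exists M; split; first exact: num_real.
by move=> M' MM' x Ax; exact: le_trans (HM x Ax) (ltW MM').
Qed.

Lemma is_derive_norm_powR (q x : R) : 0 < x ->
  is_derive x 1 (fun r => `|r| `^ q) (q * x `^ (q - 1)).
Proof.
move=> x0; apply: near_eq_is_derive (is_derive1_powR q x0).
by near=> y; rewrite gtr0_norm //; near: y; exact: lt_nbhsr.
Unshelve. all: by end_near. Qed.

(** The absolute value is there for continuity on the whole line: a nonzero power
    of a negative base is 1 by convention. *)
Lemma continuous_norm_powR (q : R) : 0 <= q -> continuous (fun r : R => `|r| `^ q).
Proof.
rewrite le_eqVlt => /predU1P[<-|q0] x.
  under eq_fun do rewrite powRr0; exact: cvg_cst.
have [->|x0] := eqVneq x 0.
  apply/cvgrPdist_lt => e e0; rewrite normr0 powR0 ?gt_eqF //.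
  have ee : 0 < e `^ q^-1 by exact: powR_gt0.
  near=> y.
  have ye : `|y| < e `^ q^-1.
    near: y; apply/nbhs_normP; exists (e `^ q^-1) => //= y.
    by rewrite /= sub0r normrN.
  rewrite sub0r normrN norm_powR // normr_id.
  have -> : e = (e `^ q^-1) `^ q by rewrite -powRrM mulVf ?gt_eqF // powRr1 // ltW.
  by apply: gt0_ltr_powR; rewrite ?nnegrE // ltW.
have nx : 0 < `|x| by rewrite normr_gt0.
apply: (@continuous_comp _ _ _ (fun r : R => `|r|) (fun r => r `^ q)).
  exact: norm_continuous.
apply/differentiable_continuous/derivable1_diffP.
by have [] := is_derive1_powR q nx.
Unshelve. all: by end_near. Qed.

Lemma powR_MVT (q u v : R) : 0 < q -> 0 <= u <= v ->
  exists2 c, u <= c <= v & v `^ q - u `^ q = q * c `^ (q - 1) * (v - u).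
Proof.
move=> q0 /andP[u0]; rewrite le_eqVlt => /predU1P[->|uv].
  by exists v; rewrite ?lexx // !subrr mulr0.
have dphi c : c \in `]u, v[%R -> is_derive c 1 (fun r => `|r| `^ q) (q * c `^ (q - 1)).
  rewrite in_itv /= => /andP[uc _]; apply: is_derive_norm_powR; exact: le_lt_trans uc.
have [c] := MVT uv dphi (continuous_subspaceT (continuous_norm_powR (ltW q0))).
rewrite in_itv /= => /andP[uc cv]; rewrite !ger0_norm ?(le_trans u0) ?(ltW uv) // => E.
by exists c => //; rewrite !ltW.
Qed.

Lemma powR_lipschitz (q u v M : R) : 1 <= q -> 0 <= u <= v -> v <= M ->
  v `^ q - u `^ q <= q * M `^ (q - 1) * (v - u).
Proof.
move=> q1 uv vM; have [c /andP[uc cv] ->] := powR_MVT (lt_le_trans ltr01 q1) uv.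
have /andP[u0 uv'] := uv.
apply: ler_wpM2r; first by rewrite subr_ge0.
apply: ler_wpM2l; first by rewrite (le_trans ler01).
by apply: ge0_ler_powR; rewrite ?nnegrE ?subr_ge0 //; lra.
Qed.

(** Taylor formula of order one for the power [p >= 2], with a quadratic remainder
    uniform on [[0, M]]; the mean value theorem is applied to the power and to its
    derivative, whose exponent [p - 1] is at least 1. *)
Lemma powR_taylor (p r r' M : R) : 2 <= p -> 0 <= r <= M -> 0 <= r' <= M ->
  r' `^ p <= r `^ p + p * r `^ (p - 1) * (r' - r)
    + p * ((p - 1) * M `^ (p - 2)) * (r' - r) ^+ 2.
Proof.
move=> p2 /andP[r0 rM] /andP[r'0 r'M].
have p0 : 0 < p by lra.
have q1 : 1 <= p - 1 by lra.
have E : p - 1 - 1 = p - 2 by lra.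
have [rr|/ltW rr] := leP r r'.
  have rr0 : 0 <= r <= r' by rewrite r0.
  have [c /andP[rc cr] H] := powR_MVT p0 rr0.
  have := @powR_lipschitz (p - 1) r c M q1; rewrite r0 rc E (le_trans cr r'M) => /(_ isT isT) H'.
  have H2 : (p - 1) * M `^ (p - 2) * (c - r) <= (p - 1) * M `^ (p - 2) * (r' - r).
    by apply: ler_wpM2l; [rewrite mulr_ge0 ?powR_ge0 //; lra|lra].
  have H3 : p * (r' - r) * c `^ (p - 1) <=
     p * (r' - r) * (r `^ (p - 1) + (p - 1) * M `^ (p - 2) * (r' - r)).
    by apply: ler_wpM2l; [rewrite mulr_ge0 ?subr_ge0 // ltW|lra].
  by move: H H3; clear; lra.
have rr0 : 0 <= r' <= r by rewrite r'0.
have [c /andP[rc cr] H] := powR_MVT p0 rr0.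
have := @powR_lipschitz (p - 1) c r M q1; rewrite (le_trans r'0 rc) cr E rM => /(_ isT isT) H'.
have H2 : (p - 1) * M `^ (p - 2) * (r - c) <= (p - 1) * M `^ (p - 2) * (r - r').
  by apply: ler_wpM2l; [rewrite mulr_ge0 ?powR_ge0 //; lra|lra].
have H3 : p * (r - r') * (r `^ (p - 1) - (p - 1) * M `^ (p - 2) * (r - r')) <= p * (r - r') * c `^ (p - 1).
  by apply: ler_wpM2l; [rewrite mulr_ge0 ?subr_ge0 // ltW|lra].
by move: H H3; clear; lra.
Qed.

(** From [ln y < y] at [y = 1 / sqrt x]. *)
Lemma norm_xlnx_le (x : R) : 0 < x <= 1 -> `|x * ln x| <= 2 * Num.sqrt x.
Proof.
move=> /andP[x0 x1].
set z := Num.sqrt x; have z0 : 0 < z by rewrite sqrtr_gt0.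
have zx : z ^+ 2 = x by rewrite sqr_sqrtr // ltW.
have lx : ln x = 2 * ln z by rewrite -zx lnXn // mulr_natl.
have lz : - ln z < z^-1 by rewrite -lnV ?posrE //; apply: ln_sublinear; rewrite invr_gt0.
have H : z ^+ 2 * - ln z <= z ^+ 2 * z^-1 by rewrite ler_wpM2l ?exprn_ge0 // ltW.
have E : z ^+ 2 * z^-1 = z by rewrite expr2 mulfK // gt_eqF.
rewrite ler0_norm; last by rewrite pmulr_rle0 // ln_le0.
by rewrite lx -zx; rewrite E in H; lra.
Qed.

Lemma continuous_xlnx : continuous (fun x : R => `|x| * ln `|x|).
Proof.
move=> x; have [->|x0] := eqVneq x 0; last first.
  have nx : 0 < `|x| by rewrite normr_gt0.
  have c1 : {for x, continuous (fun r : R => `|r|)} by exact: norm_continuous.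
  have c2 : {for x, continuous (fun r : R => ln `|r|)}.
    by apply: continuous_comp => //; exact: continuous_ln.
  exact: cvgM c1 c2.
apply/cvgrPdist_lt => e e0; rewrite normr0 mul0r.
near=> y; rewrite sub0r normrN.
have [->|y0] := eqVneq y 0; first by rewrite normr0 mul0r normr0.
have ny : 0 < `|y| by rewrite normr_gt0.
have y1 : `|y| <= 1.
  by near: y; apply/nbhs_normP; exists 1 => //= y; rewrite /= sub0r normrN => /ltW.
have H : `| `|y| * ln `|y| | <= 2 * Num.sqrt `|y| by apply: norm_xlnx_le; rewrite ny.
apply: (le_lt_trans H).
have he : 0 < 2^-1 * e by rewrite mulr_gt0.
have ye : `|y| < (2^-1 * e) ^+ 2.
  near: y; apply/nbhs_normP; exists ((2^-1 * e) ^+ 2) => /=.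
    by rewrite exprn_gt0 // mulr_gt0.
  by move=> y; rewrite /= sub0r normrN.
rewrite -ltr_pdivlMl //.
by rewrite -[ltRHS](gtr0_norm he) -(sqrtr_sqr (2^-1 * e)) ltr_sqrt // exprn_gt0.
Unshelve. all: by end_near. Qed.

End ScalarFunctions.

Section BoundedContinuous.
Context {R : realType} {d : nat}.
Implicit Types f g : 'rV[R]_d -> R.

Lemma Cb_comp f (chi : R -> R) : Cb f -> continuous chi -> Cb (fun x => chi (f x)).
Proof.
move=> [cf /bounded_realP [M HM]] cc; split.
  by move=> x; exact: continuous_comp (cf x) (cc _).
have /compact_bounded [N [_ HN]] : compact (chi @` `[- M, M]%classic).
  by apply: continuous_compact; [exact: continuous_subspaceT|exact: segment_compact].
apply/bounded_realP; exists (N + 1) => x _; apply: HN; first by rewrite ltrDl.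
by exists (f x) => //; rewrite /= in_itv /= -ler_norml HM.
Qed.

Lemma CbM f g : Cb f -> Cb g -> Cb (fun x => f x * g x).
Proof.
move=> [cf /bounded_realP [M HM]] [cg /bounded_realP [N HN]]; split.
  by move=> x; exact: cvgM (cf x) (cg x).
apply/bounded_realP; exists (M * N) => x _; rewrite normrM.
by apply: ler_pM => //; [exact: HM|exact: HN].
Qed.

Lemma CbD f g : Cb f -> Cb g -> Cb (fun x => f x + g x).
Proof.
move=> [cf /bounded_realP [M HM]] [cg /bounded_realP [N HN]]; split.
  by move=> x; exact: cvgD (cf x) (cg x).
apply/bounded_realP; exists (M + N) => x _; apply: le_trans (ler_normD _ _) _.
by apply: lerD => //; [exact: HM|exact: HN].
Qed.

Lemma Cb_cst (c : R) : Cb (fun _ : 'rV[R]_d => c).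
Proof. by split; [exact: cst_continuous|apply/bounded_realP; exists `|c|]. Qed.

Lemma Cb_sqr_grad f : C1b f -> Cb (fun x => enorm (grad f x) ^+ 2).
Proof.
move=> [f1 bf bdf].
have -> : (fun x => enorm (grad f x) ^+ 2) = (fun x => \sum_i partial i f x * partial i f x).
  by apply/funext => x; rewrite sqr_enorm /dotp; apply: eq_bigr => i _; rewrite !mxE.
elim: (index_enum _) => [|i s IH].
  by under eq_fun do rewrite big_nil; exact: Cb_cst.
under eq_fun do rewrite big_cons; apply: CbD IH.
have ci : Cb (partial i f) by split; [exact: (f1.2 i).2|exact: bdf].
exact: CbM.
Qed.

End BoundedContinuous.

(** * Consequences of the local regularity of solutions and drift *)

Section SolutionsAndDrift.
Context {R : realType} {d : nat}.
Implicit Types (f g : 'rV[R]_d -> R) (x y w : 'rV[R]_d).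

(** Parabolic regularity on the compact sets [{t} x ball] bounds the spatial increment
    at fixed time by a power of the distance. *)
Lemma holder_continuous theta J (v : R -> 'rV[R]_d -> R) t : 0 < theta ->
  parabolic_holder_loc theta J v -> J t -> continuous (v t).
Proof.
move=> th0 hv Jt.
suff cx (x : 'rV[R]_d) : v t y @[y --> x] --> v t x by exact: cx.
pose B : set 'rV[R]_d := [set y | `|y - x| <= 1].
have cB : compact B.
  apply: bounded_closed_compact.
    exists (1 + `|x|); split; first exact: num_real.
    move=> M HM y /= yB; rewrite (le_trans _ (ltW HM)) // -[y](subrK x).
    by apply: le_trans (ler_normD _ _) _; rewrite lerD.
  apply: (@preimage_closed _ _ (fun y => `|y - x|) [set r | r <= 1]); last exact: closed_le.
  move=> y _; apply: (@continuous_comp _ _ _ (fun y => y - x) (fun z => `|z|)).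
    exact: (cvgB cvg_id (cvg_cst _)).
  exact: norm_continuous.
have cK : compact ([set t] `*` B) by apply: compact_setX => //; exact: compact_set1.
have KJ : [set t] `*` B `<=` J `*` setT by move=> z [/= -> _].
have [C HC] := hv _ cK KJ.
have Hx y : B y -> `|v t x - v t y| <= C * `|enorm (y - x)| `^ theta.
  have Bx : B x by rewrite /B /= subrr normr0.
  move=> By; have := HC (t, y) (t, x) (conj erefl By) (conj erefl Bx).
  rewrite /= subrr normr0 powR0 ?add0r; last by rewrite gt_eqF // divr_gt0.
  by rewrite distrC (ger0_norm (enorm_ge0 _)).
have ce : C * `|enorm (y - x)| `^ theta @[y --> x] --> (0 : R).
  have e00 : enorm (x - x) = 0 by rewrite subrr /enorm dotp0l sqrtr0.
  have c1 : y - x @[y --> x] --> x - x by exact: (cvgB cvg_id (cvg_cst _)).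
  have c2 : enorm (y - x) @[y --> x] --> (0 : R).
    rewrite -e00; exact: (cvg_comp _ _ c1 (@enorm_continuous R d _)).
  have c3 : `|r| `^ theta @[r --> (0 : R)] --> (0 : R).
    by have := @continuous_norm_powR R theta (ltW th0) 0; rewrite /continuous_at normr0 powR0 // gt_eqF.
  by rewrite -(mulr0 C); exact: (cvgM (cvg_cst _) (cvg_comp _ _ c2 c3)).
have nB : \forall y \near x, B y.
  by apply/nbhs_normP; exists 1 => //= y; rewrite /B /= distrC => /ltW.
apply/(@cvgrPdist_lt _ _ _ (nbhs x) _) => e e0.
move/cvgrPdist_lt : ce => /(_ _ e0) ce.
near=> y.
have By : B y by near: y; exact: nB.
apply: le_lt_trans (Hx y By) _; apply: le_lt_trans (ler_norm _) _.
by rewrite -normrN -[- _]sub0r; near: y.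
Unshelve. all: by end_near. Qed.

Lemma solution_classical Q (b : R -> 'rV[R]_d -> 'rV[R]_d) theta s f u : 0 < theta ->
  bounded_classical_solution Q b theta s f u ->
  classical s u /\ forall t x, s < t -> heat Q b u t x = 0.
Proof.
move=> th0 [cu _ ru eu _]; split; last by move=> t x st; rewrite /heat eu // subrr.
have Jt t : s < t -> `]s, +oo[%classic t by move=> st; rewrite /= in_itv /= st.
split => // [t st|t x st]; last by apply: (pC12_derivable_t ru); exact: Jt.
split.
  split; first exact: holder_continuous th0 (pC12_holder ru) (Jt t st).
  move=> i; split; first by move=> x; apply: (pC12_derivable_x ru); exact: Jt.
  exact: holder_continuous th0 (pC12_holder_x ru i) (Jt t st).
move=> j; split; first exact: holder_continuous th0 (pC12_holder_x ru j) (Jt t st).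
move=> i; split; first by move=> x; apply: (pC12_derivable_xx ru); exact: Jt.
exact: holder_continuous th0 (pC12_holder_xx ru i j) (Jt t st).
Qed.

(** The mean value theorem along the segment from [x] to [y] integrates the bound
    on the Jacobian. *)
Lemma drift_monotone (b : R -> 'rV[R]_d -> 'rV[R]_d) theta r0 J t x y : 0 < theta ->
  (forall i, parabolic_holder_loc theta J (b_comp b i)) ->
  drift_dissipative b theta r0 J -> J t ->
  dotp (b t y - b t x) (y - x) <= r0 * dotp (y - x) (y - x).
Proof.
move=> th0 hb [db hdb diss] Jt; set w := y - x.
have b1 i : C1 (b_comp b i t).
  split; first exact: holder_continuous th0 (hb i) Jt.
  by move=> j; split; [move=> z; exact: db|exact: holder_continuous th0 (hdb i j) Jt].
have dpsi (s : R) : is_derive s 1 (fun s : R => dotp (b t (s *: w + x)) w)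
    (quad_form (jac_b b t (s *: w + x)) w).
  have -> : (fun s : R => dotp (b t (s *: w + x)) w) =
     \sum_(i < d) (fun s : R => (w 0 i *: (fun s => b_comp b i t (s *: w + x))) s).
    by apply/funext => r; rewrite fct_sumE; apply: eq_bigr => i _; rewrite mulrC.
  have -> : quad_form (jac_b b t (s *: w + x)) w =
      \sum_(i < d) w 0 i * dotp (grad (b_comp b i t) (s *: w + x)) w.
    rewrite /quad_form {1}/dotp; apply: eq_bigr => i _; rewrite !mxE mulrC.
    by congr (_ * _); apply: eq_bigr => j _; rewrite !mxE.
  apply: is_derive_sum => i; apply: is_deriveZ; exact: is_derive_C1_line.
have [c _] := MVT_from0 1 dpsi.
rewrite scale1r scale0r add0r mulr1 subrK => E.
by rewrite dotpDl dotpNl E -sqr_enorm; exact: diss.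
Qed.

End SolutionsAndDrift.

(** * First-order expansion of C1 functions *)

Section FirstOrderRemainder.
Context {R : realType} {d : nat}.
Implicit Types (f : 'rV[R]_d -> R) (x y : 'rV[R]_d).

Lemma norm_dotp_le x y : `|dotp x y| <= enorm x * enorm y.
Proof.
rewrite ler_norml dotp_le_enorm andbT lerNl -dotpNl.
by apply: le_trans (dotp_le_enorm _ _) _; rewrite /enorm dotpNl dotpNr opprK.
Qed.

Lemma grad_MVT f x y : C1 f -> exists2 s : R, `|s| <= 1 &
  f y - f x = dotp (grad f (s *: (y - x) + x)) (y - x).
Proof.
move=> f1; have [s] := MVT_from0 1 (fun s => is_derive_C1_line x (y - x) s f1).
by rewrite normr1 scale1r scale0r add0r mulr1 subrK => s1 E; exists s.
Qed.

Lemma C1b_lipschitz f : C1b f ->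
  exists2 L, 0 < L & forall x y, `|f y - f x| <= L * enorm (y - x).
Proof.
move=> f1; have [c1 _ _] := f1; have [_ /bounded_realP [M HM]] := Cb_sqr_grad f1.
exists (Num.sqrt M + 1); first by rewrite ltr_wpDl // sqrtr_ge0.
move=> x y; have [s _ ->] := grad_MVT x y c1.
apply: le_trans (norm_dotp_le _ _) _; apply: ler_wpM2r; first exact: enorm_ge0.
set g := grad _ _; apply: (@le_trans _ _ (Num.sqrt M)); last by rewrite lerDl.
rewrite -(ger0_norm (enorm_ge0 g)) -sqrtr_sqr ler_wsqrtr //.
by apply: le_trans (ler_norm _) _; exact: HM.
Qed.

(** Continuity of the gradient makes the expansion uniform near each point, and
    compactness of [K] makes it uniform on [K]. *)
Lemma uniform_first_order f (K : set 'rV[R]_d) e : C1 f -> compact K -> 0 < e ->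
  exists2 del : R, 0 < del & forall x y, K x -> enorm (y - x) < del ->
    `|f y - f x| <= (enorm (grad f x) + e) * enorm (y - x).
Proof.
move=> f1 cK e0.
pose P (del : R) x := forall y, enorm (y - x) < del ->
   `|f y - f x| <= (enorm (grad f x) + e) * enorm (y - x).
have nb (r : R) (x0 : 'rV[R]_d) : 0 < r -> \forall x \near x0, `|x0 - x| < r.
  by move=> r0; apply/nbhs_normP; exists r.
have : \forall del \near 0^'+, K `<=` P del.
  apply: ((compact_near_coveringP K).1 cK) => x0 Kx0.
  pose q z := enorm (grad f z - grad f x0).
  have cq : {for x0, continuous q}.
    apply: (@continuous_comp _ _ _ _ (@Num.sqrt R)); last exact: sqrt_continuous.
    apply: (@cvg_sumr _ _ _ (nbhs x0) _) => i.
    have ci : {for x0, continuous (fun z => (grad f z - grad f x0) 0 i)}.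
      have -> : (fun z => (grad f z - grad f x0) 0 i) = (fun z => partial i f z - partial i f x0).
        by apply/funext => z; rewrite !mxE.
      exact: (cvgB ((f1.2 i).2 x0) (cvg_cst _)).
    exact: (cvgM ci ci).
  have e20 : 0 < e / 2 by rewrite divr_gt0.
  have q0 : q x0 = 0 by rewrite /q subrr /enorm dotp0l sqrtr0.
  move/cvgrPdist_lt : cq => /(_ _ e20) /nbhs_normP [r /= r0 Hr].
  have {}Hr z : `|z - x0| < r -> q z < e / 2.
    move=> zr; have := Hr z; rewrite /= distrC => /(_ zr).
    by rewrite q0 sub0r normrN ger0_norm ?enorm_ge0.
  have r20 : 0 < r / 2 by rewrite divr_gt0.
  exists ([set x | `|x0 - x| < r / 2], [set del | del < r / 2]).
    split => /=; last exact: nbhs_right_lt.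
    exact: nb.
  move=> [x del] [/= xr dr] y yx.
  have [s s1 ->] := grad_MVT x y f1.
  set z := s *: (y - x) + x.
  have zx : `|z - x| < r / 2.
    rewrite /z addrK normrZ; apply: le_lt_trans (lt_trans yx dr).
    apply: le_trans (le_norm_enorm _); exact: ler_piMl.
  have qz : q z < e / 2.
    apply: Hr; rewrite -(subrK x z) -addrA (le_lt_trans (ler_normD _ _)) //.
    by rewrite [ltRHS](splitr r) ltrD // distrC.
  have qx : q x < e / 2.
    by apply: Hr; rewrite distrC; apply: lt_trans xr _; rewrite gtr_pMr // invf_lt1 // ltr1n.
  have -> : grad f z = grad f x + ((grad f z - grad f x0) - (grad f x - grad f x0)).
    by apply/rowP => i; move: (grad f z) (grad f x) (grad f x0) => u1 u2 u3; rewrite !mxE; ring.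
  set A := grad f z - _; set B := grad f x - _.
  rewrite (dotpDl (grad f x) (A - B)) (dotpDl A (- B)) (dotpNl B) mulrDl.
  apply: le_trans (ler_normD _ _) _; apply: lerD; first exact: norm_dotp_le.
  apply: le_trans (ler_normB _ _) _.
  rewrite [in leRHS](splitr e) mulrDl; apply: lerD; apply: le_trans (norm_dotp_le _ _) _.
    by apply: ler_wpM2r (enorm_ge0 _) _ _ (ltW qz).
  by apply: ler_wpM2r (enorm_ge0 _) _ _ (ltW qx).
move=> H; have : \forall del \near 0^'+, 0 < del /\ K `<=` P del.
  by near=> del; split; near: del => //; exact: nbhs_right_gt.
move=> /filter_ex [del [del0 KP]]; exists del => // x y Kx; exact: KP.
Unshelve. all: by end_near. Qed.

End FirstOrderRemainder.

(** * Increments of powers of a C1 function *)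

Section PointwiseEstimates.
Context {R : realType}.

(** Both terms on the right have product [(p r^(p-1) N)^2 / 4], so this is the
    arithmetic-geometric inequality. *)
Lemma powR_young (p k r N : R) : 2 <= p -> 0 < k -> 0 <= r -> 0 <= N ->
  p * r `^ (p - 1) * N <= k * r `^ p + p ^+ 2 / (4 * k) * r `^ (p - 2) * N ^+ 2.
Proof.
move=> p2 k0 r0 N0; have p0 : 0 < p by lra.
have E : r `^ (p - 1) * r `^ (p - 1) = r `^ p * r `^ (p - 2).
  rewrite -!powRD; first by congr (_ `^ _); ring.
    by apply/implyP => /eqP ?; lra.
  by apply/implyP => /eqP ?; lra.
move: E; set u := r `^ p; set v := r `^ (p - 2); set w := r `^ (p - 1) => E.
have u0 : 0 <= u by exact: powR_ge0.
have v0 : 0 <= v by exact: powR_ge0.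
have w0 : 0 <= w by exact: powR_ge0.
have X0 : 0 <= k * u by rewrite mulr_ge0 // ltW.
have Y0 : 0 <= p ^+ 2 / (4 * k) * v * N ^+ 2.
  rewrite mulr_ge0 ?sqr_ge0 // mulr_ge0 // divr_ge0 ?sqr_ge0 // mulr_ge0 //.
  exact: ltW.
have Z0 : 0 <= p * w * N by rewrite !mulr_ge0 // ltW.
rewrite -(@ler_pXn2r _ 2) ?nnegrE ?addr_ge0 //.
have -> : (p * w * N) ^+ 2 = 4 * (k * u) * (p ^+ 2 / (4 * k) * v * N ^+ 2).
  have -> : (p * w * N) ^+ 2 = p ^+ 2 * N ^+ 2 * (w * w) by ring.
  by rewrite E; field; rewrite gt_eqF.
rewrite -subr_ge0; set X := k * u; set Y := _ * N ^+ 2.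
have -> : (X + Y) ^+ 2 - 4 * X * Y = (X - Y) ^+ 2 by ring.
exact: sqr_ge0.
Qed.

Lemma derive_le_of_upper (F : R -> R) (D A B : R) : is_derive (0 : R) 1 F D ->
  (forall h, 0 < h -> F h - F 0 <= h * A + h ^+ 2 * B) -> D <= A.
Proof.
move=> [d1 d2] H; rewrite leNgt; apply/negP => AD.
have e0 : 0 < (D - A) / 2 by rewrite divr_gt0 // subr_gt0.
have /cvgrPdist_lt /(_ _ e0) : (fun h : R => h^-1 *: ((F \o shift 0) (h *: 1) - F 0)) @ 0^' --> D.
  by rewrite -d2; exact: d1.
rewrite near_withinE => /nbhs_normP [r /= r0 Hr].
have B1 : 0 < `|B| + 1 by rewrite ltr_wpDl.
pose h := Num.min (r / 2) ((D - A) / 2 / (`|B| + 1)).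
have h0 : 0 < h by rewrite lt_min !divr_gt0 // subr_gt0.
have hr : h < r.
  apply: (@le_lt_trans _ _ (r / 2)); first by rewrite ge_min lexx.
  by rewrite ltr_pdivrMr // ltr_pMr // ltr1n.
have /Hr /(_ (lt0r_neq0 h0)) : ball_ Num.norm 0 r h by rewrite /= sub0r normrN gtr0_norm.
rewrite /= addr0 [h *: 1]mulr1 ltr_norml => /andP[_ H1].
have H2 : h^-1 * (F h - F 0) <= A + h * B.
  rewrite ler_pdivrMl //; have := H h h0; rewrite expr2; lra.
have H3 : h * B <= (D - A) / 2.
  apply: (@le_trans _ _ (h * (`|B| + 1))).
    by rewrite ler_pM2l // (le_trans (ler_norm _)) // lerDl.
  by rewrite -ler_pdivlMr // ge_min lexx orbT.
have {}H1 : D - h^-1 * (F h - F 0) < (D - A) / 2 by exact: H1.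
lra.
Qed.

Lemma le_of_le_add_eps (N X Y : R) : (forall e, 0 < e -> N <= X + e * Y) -> N <= X.
Proof.
move=> H; rewrite leNgt; apply/negP => XN.
have Y1 : 0 < `|Y| + 1 by rewrite ltr_wpDl.
have e0 : 0 < (N - X) / (`|Y| + 1) / 2 by rewrite !divr_gt0 // subr_gt0.
have := H _ e0; set e := _ / 2 in e0 *.
have H1 : e * Y <= e * (`|Y| + 1) by rewrite ler_pM2l // (le_trans (ler_norm _)) // lerDl.
have H2 : e * (`|Y| + 1) = (N - X) / 2 by rewrite /e; field; rewrite gt_eqF.
lra.
Qed.

End PointwiseEstimates.

Section PowerIncrement.
Context {R : realType} {d : nat}.
Variables (phi : 'rV[R]_d -> R).
Hypothesis cphi : continuous phi.
Hypothesis phi0 : forall x, 0 < phi x.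
Hypothesis phi_coercive : forall M, exists r, forall x, r <= enorm x -> M <= phi x.

(** Where [phi <= L / e] the expansion is uniform by compactness; elsewhere the
    Lipschitz bound [L |y - x|] is absorbed by [e phi(x) |y - x|]; distant points
    are absorbed by the quadratic term. The Lyapunov function thus stands in for a
    uniform modulus of continuity of the gradient. *)
Lemma first_order_remainder (f : 'rV[R]_d -> R) (e : R) : C1b f -> 0 < e ->
  exists2 C, 0 <= C & forall x y, `|f y - f x| <=
    enorm (grad f x) * enorm (y - x) + e * (1 + phi x) * enorm (y - x) + C * enorm (y - x) ^+ 2.
Proof.
move=> f1 e0; have [L L0 HL] := C1b_lipschitz f1; have [c1 _ _] := f1.
have [del del0 Hd] := uniform_first_order c1 (sublevel_compact (M := L / e) cphi phi_coercive) e0.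
exists (L / del) => [|x y]; first by rewrite divr_ge0 // ltW.
set rho := enorm (y - x); have rho0 : 0 <= rho by exact: enorm_ge0.
have h1 : 0 <= e * phi x * rho by rewrite !mulr_ge0 // ltW.
have h2 : 0 <= L / del * rho ^+ 2 by rewrite mulr_ge0 ?sqr_ge0 // divr_ge0 // ltW.
have h3 : 0 <= enorm (grad f x) * rho by rewrite mulr_ge0 ?enorm_ge0.
have h4 : 0 <= e * rho by rewrite mulr_ge0 // ltW.
have [rd|dr] := ltP rho del; last first.
  apply: (le_trans (HL x y)); rewrite -/rho.
  have : L * rho <= L / del * rho ^+ 2.
    rewrite expr2 mulrA ler_wpM2r // -mulrA ler_pMr //.
    by rewrite mulrC ler_pdivlMr // mul1r.
  by move: h1 h3 h4; clear; lra.
have [xK|] := leP (phi x) (L / e).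
  have := Hd x y xK rd; rewrite -/rho; move: h1 h2.
  by move: `|_| (enorm (grad f x)) => u1 u2; clear; lra.
rewrite ltr_pdivrMr // => Lx; apply: (le_trans (HL x y)); rewrite -/rho.
have : L * rho <= phi x * e * rho by rewrite ler_wpM2r // ltW.
by move: h1 h2 h3 h4; clear; lra.
Qed.

Lemma powR_increment (f : 'rV[R]_d -> R) (p e : R) : C1b f -> 2 <= p -> 0 < e ->
  exists2 C, 0 <= C & forall x y, `|f y| `^ p <=
    `|f x| `^ p + p * `|f x| `^ (p - 1) * (enorm (grad f x) * enorm (y - x))
     + e * (1 + phi x) * enorm (y - x) + C * enorm (y - x) ^+ 2.
Proof.
move=> f1 p2 e0; have [L L0 HL] := C1b_lipschitz f1.
have [_ /bounded_realP [M HM] _] := f1.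
have {}HM x : `|f x| <= M by exact: HM.
have p0 : 0 < p by lra.
(* A bounds the slopes p r^(p-1), hence the rescaling e / A of the remainder *)
set A := p * M `^ (p - 1) + 1.
have A0 : 0 < A by rewrite ltr_wpDl // mulr_ge0 ?powR_ge0 // ltW.
have [C C0 HC] := first_order_remainder f1 (divr_gt0 e0 A0).
set T := p * ((p - 1) * M `^ (p - 2)).
have T0 : 0 <= T by rewrite !mulr_ge0 ?powR_ge0 //; lra.
exists (A * C + T * L ^+ 2) => [|x y].
  by rewrite addr_ge0 // mulr_ge0 ?sqr_ge0 // ltW.
have M0 : 0 <= M by exact: le_trans (HM x).
have := @powR_taylor _ p `|f x| `|f y| M p2; rewrite !normr_ge0 !HM => /(_ isT isT).
have := HC x y; have := HL x y.
set rho := enorm (y - x); have rho0 : 0 <= rho by exact: enorm_ge0.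
set N := enorm (grad f x).
have fxy : `|f y| - `|f x| <= `|f y - f x| by exact: lerB_dist.
have fxy2 : (`|f y| - `|f x|) ^+ 2 <= `|f y - f x| ^+ 2.
  by rewrite -real_normK ?num_real // ler_pXn2r ?nnegrE //; exact: ler_dist_dist.
have wA : p * `|f x| `^ (p - 1) <= A.
  apply: (@le_trans _ _ (p * M `^ (p - 1))); last by rewrite lerDl.
  rewrite ler_pM2l //; apply: ge0_ler_powR; rewrite ?nnegrE //; lra.
have w0 : 0 <= p * `|f x| `^ (p - 1) by rewrite mulr_ge0 ?powR_ge0 // ltW.
have ph := phi0 x.
move: (`|f x| `^ (p - 1)) (`|f x| `^ p) (`|f y| `^ p) w0 wA => w u u' w0 wA.
move: (`|f y - f x|) (normr_ge0 (f y - f x)) fxy fxy2 => D D0 fxy fxy2 HD1 HD2 HT.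
rewrite -/T in HT.
have D2 : D ^+ 2 <= (L * rho) ^+ 2 by rewrite ler_pXn2r ?nnegrE // mulr_ge0 // ltW.
have s1 : T * (`|f y| - `|f x|) ^+ 2 <= T * (L * rho) ^+ 2.
  by rewrite ler_wpM2l // (le_trans fxy2).
have s2 : p * w * (`|f y| - `|f x|) <= p * w * D by rewrite ler_wpM2l.
have s3 : p * w * D <= p * w * (N * rho + e / A * (1 + phi x) * rho + C * rho ^+ 2).
  by rewrite ler_wpM2l.
have s4 : p * w * (e / A * (1 + phi x) * rho + C * rho ^+ 2) <=
          A * (e / A * (1 + phi x) * rho + C * rho ^+ 2).
  rewrite ler_wpM2r // addr_ge0 // !mulr_ge0 ?sqr_ge0 // ?invr_ge0 ?(ltW A0) ?(ltW e0) //.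
  by rewrite addr_ge0 // ltW.
have s5 : A * (e / A * (1 + phi x) * rho + C * rho ^+ 2) = e * (1 + phi x) * rho + A * C * rho ^+ 2.
  by field; rewrite gt_eqF.
move: HT s1 s2 s3 s4; rewrite s5 exprMn.
move: (`|f y| - `|f x|) (rho ^+ 2) => D' rho2; rewrite !mulrDr !mulrDl !mulrA.
by clear; lra.
Qed.

End PowerIncrement.

(** * Dissipation of the entropy *)

Section EntropyFunction.
Context {R : realType} {d : nat}.
Variables (Q : R -> 'M[R]_d) (b : R -> 'rV[R]_d -> 'rV[R]_d).

Lemma trace_mul_rank1 (M : 'M[R]_d) (g : 'rV[R]_d) : \tr (M *m (g^T *m g)) = quad_form M g.
Proof. by rewrite mulmxA mxtrace_mulC mulmxA quad_formE /mxtrace big_ord1. Qed.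

Lemma opA_comp t (f : 'rV[R]_d -> R) (psi dpsi ddpsi : R -> R) : C2 f ->
  (forall x, is_derive (f x) 1 psi (dpsi (f x))) ->
  (forall x, is_derive (f x) 1 dpsi (ddpsi (f x))) ->
  (forall x, {for f x, continuous ddpsi}) ->
  C2 (fun x => psi (f x)) /\ forall x, opA Q b t (fun x => psi (f x)) x =
    dpsi (f x) * opA Q b t f x + ddpsi (f x) * quad_form (Q t) (grad f x).
Proof.
move=> [f1 f2] d1 d2 c3.
have c2 x : {for f x, continuous dpsi}.
  by apply/differentiable_continuous/derivable1_diffP; have [] := d2 x.
have [p1 p1E] := C1_comp f1 d1 c2; have [q1 q1E] := C1_comp f1 d2 c3.
have g1 j := C1M q1 (f2 j).
split.
  split; first exact: p1.
  by move=> j; rewrite p1E; exact: (g1 j).1.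
move=> x; rewrite /opA (gradE x p1E) (hess_intro x p1E (fun i j => (g1 j).2 i)).
have -> : \row_i (dpsi (f x) * partial i f x) = dpsi (f x) *: grad f x.
  by apply/rowP => i; rewrite !mxE.
have -> : \matrix_(i, j) (dpsi (f x) * partial i (partial j f) x
     + partial j f x * partial i (fun x => dpsi (f x)) x)
   = dpsi (f x) *: hess f x + ddpsi (f x) *: ((grad f x)^T *m grad f x).
  apply/matrixP => i j; rewrite [LHS]mxE [RHS]mxE q1E; congr (_ + _); first by rewrite !mxE.
  by rewrite mxE [(_ *m _) i j]mxE big_ord1 !mxE; ring.
rewrite mulmxDr mxtraceD -!scalemxAr !mxtraceZ trace_mul_rank1 dotpZr; ring.
Qed.

Lemma is_derive_xlnx (r : R) : 0 < r -> is_derive r 1 (fun r => r * ln r) (ln r + 1).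
Proof.
move=> r0; have := is_deriveM (is_derive_id r (1 : R)) (is_derive1_ln r0).
by move=> /is_derive_eq; apply; rewrite /GRing.scale /= mulfV ?gt_eqF // mulr1 addrC.
Qed.

Lemma is_derive_lnD1 (r : R) : 0 < r -> is_derive r 1 (fun r => ln r + 1) r^-1.
Proof.
move=> r0; have := is_deriveD (is_derive1_ln r0) (is_derive_cst (1 : R) r (1 : R)).
by move=> /is_derive_eq; apply; rewrite addr0.
Qed.

(** For [psi(r) = r ln r] the chain rule gives [A psi(u) = psi'(u) A u + psi''(u) <Q Du, Du>],
    and [psi''(r) = 1 / r]. The shift by [e] keeps the argument positive where [u]
    vanishes. *)
Lemma entropy_classical s u e : 0 < e -> classical s u ->
  (forall t x, s <= t -> 0 <= u t x) -> (forall t x, s < t -> heat Q b u t x = 0) ->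
  classical s (fun t x => (u t x + e) * ln (u t x + e)) /\
  forall t x, s < t -> heat Q b (fun t x => (u t x + e) * ln (u t x + e)) t x =
    - ((u t x + e)^-1 * quad_form (Q t) (grad (u t) x)).
Proof.
move=> e0 uc u0 hu.
have [ec eh] := classical_space Q b s (C2_cst e).
have [] := classicalD Q b uc ec.
set w := fun t x => u t x + e => wc wh.
have w0 t x : s <= t -> 0 < w t x by move=> st; rewrite ltr_wpDl // u0.
have gw t x : s < t -> grad (w t) x = grad (u t) x.
  move=> st; rewrite (gradD x (classical_C2 uc st).1 (C1_cst e).1) grad_cst addr0 //.
have hw t x : s < t -> heat Q b w t x = 0.
  by move=> st; rewrite wh // hu // eh opA_cst oppr0 addr0.
have H t : s < t -> _ := fun st => @opA_comp t (w t) (fun r => r * ln r) (fun r => ln r + 1) (fun r => r^-1)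
  (classical_C2 wc st) (fun x => is_derive_xlnx (w0 t x (ltW st)))
  (fun x => is_derive_lnD1 (w0 t x (ltW st)))
  (fun x => @inv_continuous _ _ (lt0r_neq0 (w0 t x (ltW st)))).
have dw t x : s < t -> is_derive t 1 (fun r => w r x * ln (w r x)) ((ln (w t x) + 1) * Dt w t x).
  move=> st; have := is_derive_xlnx (w0 t x (ltW st)).
  move=> /(@is_derive1_comp _ (fun r => r * ln r) (fun r => w r x) t _ (Dt w t x)); apply.
  rewrite /Dt derive1E; apply: derivableP. exact: (classical_derivable wc (x:=x) st).
split.
  split => [|t st|t x st].
  - apply: (@subspace_eq_continuous _ _ _ (fun y : R * 'rV[R]_d => `|w y.1 y.2| * ln `|w y.1 y.2|)).
      move=> [t x]; rewrite inE => -[/=]; rewrite in_itv /= andbT => st _.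
      by rewrite gtr0_norm // w0.
    have /subspace_continuousP cw := classical_continuous wc.
    apply/subspace_continuousP => y /cw cy.
    exact: (cvg_comp _ _ cy (@continuous_xlnx R _)).
  - exact: (H t st).1.
  - by have [] := dw t x st.
move=> t x st; rewrite /heat (H t st).2 gw // {1}/Dt derive1E.
have [_ ->] := dw t x st; have := hw t x st; rewrite /heat => /eqP; rewrite subr_eq0 => /eqP ->.
by rewrite opprD addrA subrr add0r.
Qed.

End EntropyFunction.

(** * Gradient bound and logarithmic Sobolev inequality *)

Lemma increment_arith {R : realType} (kd eps del A C g g' p w v N rho z : R) :
  eps * (1 + z) * rho <= eps * (1 + z) * (del + rho ^+ 2 / del) ->
  p * w * (N * rho) <= kd * g + A * v * (N ^+ 2 * rho ^+ 2) ->
  g' <= g + p * w * (N * rho) + eps * (1 + z) * rho + C * rho ^+ 2 ->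
  g' <= (1 + kd) * g + eps * del * (z + 1) +
        rho ^+ 2 * (A * (v * N ^+ 2) + (eps / del * (z + 1) + C)).
Proof. by move=> H1 H2 H3; lra. Qed.

Lemma gradient_arith {R : realType} (u u' k del e psi X Y E N Z : R) :
  u' <= (1 + k * del) * u + e * del * psi + (del * (X + e * (psi * (E * N))) + Z) ->
  u' - u <= del * (k * u + X + e * (psi * (1 + E * N))) + Z.
Proof. by move=> H; lra. Qed.

(** The derivative of [K (1 - exp(2 r0 (t - s)))] is [2 p^2 Lambda exp(2 r0 (t - s))]
    for the constant [K] below; it dominates the dissipation
    [<Q Du, Du> / (u + e)] by the gradient bound. *)
Lemma entropy_arith {R : realType} (p Lambda r0 K E U H e q n : R) :
  0 < e -> 0 <= Lambda -> r0 < 0 -> K = p ^+ 2 * Lambda / - r0 -> 0 <= E -> 0 <= U -> 0 <= H ->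
  n <= p ^+ 2 * E * (U * H) -> q <= Lambda * n ->
  (U + e)^-1 * q + K * (2 * r0 * E) * H <= 0.
Proof.
move=> e0 L0 r0n -> E0 U0 H0 nle qle.
have Ue : 0 < U + e by rewrite ltr_wpDl.
have -> : p ^+ 2 * Lambda / - r0 * (2 * r0 * E) * H = - (2 * (p ^+ 2 * Lambda * E * H)).
  by field; rewrite lt_eqF.
rewrite subr_le0 mulrC ler_pdivrMr //.
have X0 : 0 <= p ^+ 2 * Lambda * E * H by exact: (mulr_ge0 (mulr_ge0 (mulr_ge0 (sqr_ge0 p) L0) E0) H0).
have := ler_wpM2l L0 nle.
have := mulr_ge0 X0 U0; have := mulr_ge0 X0 (ltW e0).
lra.
Qed.

Section LogSobolev.
Context {R : realType} {d : nat}.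
Variables (Q : R -> 'M[R]_d) (b : R -> 'rV[R]_d -> 'rV[R]_d).
Variables (I : set R) (phi : 'rV[R]_d -> R) (a r0 theta : R).
Hypothesis setting : dissipative_setting Q b I phi a r0.
Hypothesis theta0 : 0 < theta.

Let solution s f u := bounded_classical_solution Q b theta s f u.

Lemma classicalZ s c F : classical s F -> classical s (fun t (x : 'rV[R]_d) => c * F t x) /\
  forall t x, s < t -> heat Q b (fun t x => c * F t x) t x = c * heat Q b F t x.
Proof.
move=> Fc; have dc (t : R) : is_derive t 1 (fun=> c) 0 by exact: is_derive_cst.
have [H1 H2] := classicalMt Q b dc Fc; split; first exact: H1.
by move=> t x st; rewrite H2 // mul0r addr0.
Qed.

Lemma solution_bound s f u : solution s f u ->
  exists M, forall t x, s <= t -> `|u t x| <= M.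
Proof.
move=> uS; have /bounded_realP [M HM] := bcs_bounded uS; exists M => t x st.
by apply: (HM (t, x)); split => //=; rewrite in_itv /= st.
Qed.

Lemma solution_ge0 s f u : I s -> solution s f u -> (forall x, 0 <= f x) ->
  forall t x, s <= t -> 0 <= u t x.
Proof.
move=> Is uS f0 t x st; have [uc uh] := solution_classical theta0 uS.
have [M HM] := solution_bound uS; have [nc nh] := classicalZ (-1) uc.
have := @comparison _ _ _ _ _ _ _ _ setting s _ M Is nc _ _ _ t x st.
rewrite mulN1r oppr_le0; apply.
- move=> {}t {}x {}st; rewrite mulN1r; apply: le_trans (ler_norm _) _.
  by rewrite normrN HM.
- by move=> {}x; rewrite mulN1r oppr_le0 (bcs_initial uS).
- by move=> {}t {}x {}st; rewrite nh // uh // mulr0.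
Qed.

Section Gradient.
Variables (f : 'rV[R]_d -> R) (p s : R) (u h : R -> 'rV[R]_d -> R).
Hypotheses (f1 : C1b f) (p2 : 2 <= p) (Is : I s).
Hypothesis uS : solution s (fun y => `|f y| `^ p) u.
Hypothesis hS : solution s (fun y => `|f y| `^ (p - 2) * enorm (grad f y) ^+ 2) h.

Let u0 : forall t x, s <= t -> 0 <= u t x.
Proof. by apply: (solution_ge0 Is uS) => x; exact: powR_ge0. Qed.

Let h0 : forall t x, s <= t -> 0 <= h t x.
Proof. by apply: (solution_ge0 Is hS) => x; rewrite mulr_ge0 ?powR_ge0 ?sqr_ge0. Qed.

Let Psi (t : R) x := phi x + a * (t - s) + 1.

Let Psi_classical : classical s Psi /\ forall t x, s < t -> 0 <= heat Q b Psi t x.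
Proof.
have [H1 H2] := penalty_classical setting s a.
have [H3 H4] := classical_space Q b s (C2_cst 1); have [H5 H6] := classicalD Q b H1 H3.
split; first exact: H5.
move=> t x st; rewrite [leRHS]H6 // H4 opA_cst oppr0 addr0 -[leLHS](subrr a).
by apply: H2 => //; exact: setting_upper setting _ _ Is (ltW st).
Qed.

Let Psi_ge0 t x : s <= t -> 0 <= Psi t x.
Proof.
move=> st; rewrite addr_ge0 // addr_ge0 ?(ltW (setting_pos setting x)) //.
by rewrite mulr_ge0 ?subr_ge0 // (ltW (setting_a_gt0 setting)).
Qed.

(** [coupling_comparison] with [U = u] and with [P], [S] chosen so that the initial
    inequality is the expansion of [|f|^p], split by [powR_young] and by
    [|y - x| <= del + |y - x|^2 / del]. The scale [del] is that of [|y - x|]; the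
    constant [C] does not depend on it, so its contribution disappears as [del]
    tends to 0. *)
Lemma coupled_increment (e : R) : 0 < e -> exists C, forall k del t x y,
  0 < k -> 0 < del -> s <= t ->
  u t y <= (1 + k * del) * u t x + e * del * Psi t x
    + dotp (y - x) (y - x) * (expR (2 * r0 * (t - s)) *
       (p ^+ 2 / (4 * (k * del)) * h t x + (e / del * Psi t x + C))).
Proof.
move=> e0.
have [C C0 HC] := powR_increment (setting_C2 setting).1.1 (setting_pos setting)
  (setting_coercive setting) f1 p2 e0.
exists C => k del T x0 y0 k0 del0 sT.
have kd0 : 0 < k * del by rewrite mulr_gt0.
have [uc uh] := solution_classical theta0 uS; have [hc hh] := solution_classical theta0 hS.
have [Pc Ph] := Psi_classical.
set A := p ^+ 2 / (4 * (k * del)).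
have A0 : 0 <= A by rewrite divr_ge0 ?sqr_ge0 // mulr_ge0 // ltW.
have [c1 e1] := classicalZ (1 + k * del) uc; have [c2 e2] := classicalZ (e * del) Pc.
have [c3 e3] := classicalD Q b c1 c2.
have [c4 e4] := classicalZ A hc; have [c5 e5] := classicalZ (e / del) Pc.
have [c6 e6] := classical_space Q b s (C2_cst C).
have [c7 e7] := classicalD Q b c5 c6; have [c8 e8] := classicalD Q b c4 c7.
have dm (t : R) : is_derive t 1 (fun t => expR (2 * r0 * (t - s))) (2 * r0 * expR (2 * r0 * (t - s))).
  have := is_derive1_comp (is_derive_expR _) (is_derive_affine (2 * r0) s t).
  by rewrite (mulrC (expR _)).
have [c9 e9] := classicalMt Q b dm c8.
have [M HM] := solution_bound uS.
have inner0 t x : s <= t -> 0 <= A * h t x + (e / del * Psi t x + C).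
  move=> st; rewrite !addr_ge0 // mulr_ge0 ?h0 ?Psi_ge0 //.
  by rewrite divr_ge0 // ltW.
apply: (@coupling_comparison _ _ Q b I phi a r0 setting s u _ _ M 0 Is uc c3 c9) => //.
- by move=> t x st; apply: le_trans (ler_norm _) _; exact: HM.
- move=> t x st; rewrite addr_ge0 // mulr_ge0 ?u0 ?Psi_ge0 //.
    by rewrite addr_ge0 // ltW.
  by rewrite mulr_ge0 // ltW.
- by move=> t x st; rewrite mulr_ge0 ?expR_ge0 // inner0.
- move=> x y; rewrite /Psi subrr !mulr0 expR0 addr0 mul1r (bcs_initial uS) (bcs_initial hS) -sqr_enorm.
  have := HC x y; set rho := enorm (y - x); set N := enorm (grad f x).
  have rho0 : 0 <= rho by exact: enorm_ge0.
  have := powR_young p2 kd0 (normr_ge0 (f x)) (mulr_ge0 (enorm_ge0 (grad f x)) rho0).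
  rewrite -/N -/A exprMn.
  have rd : rho <= del + rho ^+ 2 / del.
    have [rd|dr] := leP rho del.
      by rewrite (le_trans rd) // lerDl divr_ge0 ?sqr_ge0 // ltW.
    apply: (@le_trans _ _ (rho ^+ 2 / del)); last by rewrite lerDr ltW.
    by rewrite ler_pdivlMr // expr2 ler_wpM2l // ltW.
  have : e * (1 + phi x) * rho <= e * (1 + phi x) * (del + rho ^+ 2 / del).
    by rewrite ler_wpM2l // mulr_ge0 ?(ltW e0) // addr_ge0 // ltW // (setting_pos setting).
  exact: increment_arith.
- by move=> t x st; rewrite uh.
- by move=> t x st; rewrite e3 // e1 // e2 // uh // mulr0 add0r !mulr_ge0 ?Ph // ltW.
- move=> t x st; rewrite e9 // e8 // e4 // hh // e7 // e5 // e6 opA_cst oppr0 addr0 mulr0 add0r.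
  rewrite mulrA lerDr mulr_ge0 ?expR_ge0 // mulr_ge0 ?Ph //.
  by rewrite divr_ge0 // ltW.
Qed.

(** [coupled_increment] at [y = x + del * grad u], divided by [del], as [del] and then
    [e] tend to 0. *)
Lemma gradient_linear_bound k t x : 0 < k -> s < t ->
  dotp (grad (u t) x) (grad (u t) x) <= k * u t x +
   p ^+ 2 / (4 * k) * expR (2 * r0 * (t - s)) * h t x * dotp (grad (u t) x) (grad (u t) x).
Proof.
move=> k0 st; set xi := grad (u t) x; set E := expR _; set N := dotp xi xi.
apply: (@le_of_le_add_eps _ _ _ (Psi t x * (1 + E * N))) => e e0.
have [C HC] := coupled_increment e0.
have [uc _] := solution_classical theta0 uS.
have D := is_derive_C1_line x xi 0 (classical_C2 uc st).1.
rewrite scale0r add0r -/xi -/N in D.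
apply: (derive_le_of_upper (B := E * C * N) D) => del del0.
have := HC k del t x (del *: xi + x) k0 del0 (ltW st).
rewrite scale0r add0r addrK dotpZl dotpZr -/N -/E.
have -> : del * (del * N) * (E * (p ^+ 2 / (4 * (k * del)) * h t x + (e / del * Psi t x + C))) =
  del * (p ^+ 2 / (4 * k) * E * h t x * N + e * (Psi t x * (E * N))) + del ^+ 2 * (E * C * N).
  by field; rewrite !gt_eqF.
exact: gradient_arith.
Qed.

(** With [B = p^2 exp(2 r0 (t - s)) h] and [N = |grad u|^2], the linear bound reads
    [N <= k u + B N / (4 k)]; the best choice is [k = B / 2], or [k] tending to 0
    when [B = 0]. *)
Lemma gradient_bound t x : s < t ->
  enorm (grad (u t) x) ^+ 2 <= p ^+ 2 * expR (2 * r0 * (t - s)) * (u t x * h t x).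
Proof.
move=> st; have H k k0 := @gradient_linear_bound k t x k0 st.
rewrite sqr_enorm; move: H; set N := dotp _ _; set E := expR _ => H.
have B0 : 0 <= p ^+ 2 * E * h t x by exact: mulr_ge0 (mulr_ge0 (sqr_ge0 p) (expR_ge0 _)) (h0 x (ltW st)).
have N0 : 0 <= N by exact: dotpxx_ge0.
have U0 := u0 x (ltW st).
have [Bz|BN] := eqVneq (p ^+ 2 * E * h t x) 0.
  have -> : p ^+ 2 * E * (u t x * h t x) = p ^+ 2 * E * h t x * u t x by ring.
  rewrite Bz mul0r.
  apply: (@le_of_le_add_eps _ _ _ (u t x)) => k k0; rewrite add0r.
  have := H k k0.
  have -> : p ^+ 2 / (4 * k) * E * h t x * N = p ^+ 2 * E * h t x * (N / (4 * k)).
    by field; rewrite gt_eqF.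
  by rewrite Bz mul0r addr0.
have Bp : 0 < p ^+ 2 * E * h t x by rewrite lt_def BN.
(* the value of k that makes the last term equal to N / 2 *)
have kp : 0 < p ^+ 2 * E * h t x / 2 by rewrite divr_gt0.
have := H _ kp.
have -> : p ^+ 2 / (4 * (p ^+ 2 * E * h t x / 2)) * E * h t x * N = N / 2.
  have p0 : p != 0 by rewrite gt_eqF // (lt_le_trans _ p2).
  have E0 : E != 0 by rewrite gt_eqF // expR_gt0.
  have hN0 : h t x != 0 by apply: contraNneq BN => ->; rewrite mulr0.
  by field; rewrite p0 E0 hN0.
lra.
Qed.

End Gradient.

(** The log-Sobolev inequality up to a regularisation [e]. The difference of both
    sides is nonpositive at time [s], since [ln] is increasing, and a subsolution
    afterwards; [e ln e] is what the regularisation costs where [f] vanishes. *)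
Lemma entropy_comparison f (p s : R) u v h (Lambda K : R) : C1b f -> 2 <= p -> I s -> r0 < 0 -> 0 <= Lambda ->
  (forall t xi, I t -> quad_form (Q t) xi <= Lambda * enorm xi ^+ 2) ->
  solution s (fun y => `|f y| `^ p) u ->
  solution s (fun y => `|f y| `^ p * ln (`|f y| `^ p)) v ->
  solution s (fun y => `|f y| `^ (p - 2) * enorm (grad f y) ^+ 2) h ->
  K = p ^+ 2 * Lambda / `|r0| ->
  forall (e t : R) x, 0 < e -> s <= t ->
   v t x + e * ln e <= K * (1 - expR (2 * r0 * (t - s))) * h t x + (u t x + e) * ln (u t x + e).
Proof.
move=> f1 p2 Is r0n L0 Qle uS vS hS KE e T x0 e0 sT.
have u0 : forall t x, s <= t -> 0 <= u t x.
  by apply: (solution_ge0 Is uS) => x; exact: powR_ge0.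
have h0 : forall t x, s <= t -> 0 <= h t x.
  by apply: (solution_ge0 Is hS) => x; rewrite mulr_ge0 ?powR_ge0 ?sqr_ge0.
have K0 : 0 <= K by rewrite KE divr_ge0 // mulr_ge0 ?sqr_ge0.
have [uc uh] := solution_classical theta0 uS; have [hc hh] := solution_classical theta0 hS.
have [vc vh] := solution_classical theta0 vS.
have [ec eh] := entropy_classical e0 uc u0 uh.
have dm (t : R) : is_derive t 1 (fun t => - K * (1 - expR (2 * r0 * (t - s))))
   (K * (2 * r0 * expR (2 * r0 * (t - s)))).
  have := is_deriveZ (- K) (is_deriveB (is_derive_cst (1 : R) t (1 : R))
     (is_derive1_comp (is_derive_expR _) (is_derive_affine (2 * r0) s t))).
  by move=> /is_derive_eq; apply; rewrite /GRing.scale /=; ring.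
have [c1 e1] := classicalMt Q b dm hc.
have [c2 e2] := classicalZ (-1) ec.
have [c3 e3] := classical_space Q b s (C2_cst (e * ln e)).
have [c4 e4] := classicalD Q b vc c3.
have [c5 e5] := classicalD Q b c2 c1.
have [c6 e6] := classicalD Q b c4 c5.
have [M HM] := solution_bound vS.
have cK t : s <= t -> 0 <= K * (1 - expR (2 * r0 * (t - s))).
  move=> st; rewrite mulr_ge0 // subr_ge0 -expR0 ler_expR mulr_le0_ge0 ?subr_ge0 //.
  by rewrite mulr_ge0_le0 // ltW.
have xlnx (r : R) : 0 < r -> -1 <= r * ln r.
  move=> r1; rewrite lerNl -mulrN -lnV ?posrE //.
  have H : ln r^-1 <= r^-1 by apply/ltW/ln_sublinear; rewrite invr_gt0.
  by apply: le_trans (_ : r * r^-1 <= 1); [rewrite ler_pM2l|rewrite mulfV // gt_eqF].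
have := @comparison _ _ Q b I phi a r0 setting s _ (M + e * ln e + 1) Is c6 _ _ _ T x0 sT.
rewrite !mulNr mul1r => main.
suff : v T x0 + e * ln e + (- ((u T x0 + e) * ln (u T x0 + e)) +
     - (K * (1 - expR (2 * r0 * (T - s))) * h T x0)) <= 0 by lra.
apply: main.
- move=> t x st.
  have := le_trans (ler_norm _) (HM t x st).
  have := xlnx (u t x + e) (ltr_wpDl (u0 t x st) e0).
  have := mulr_ge0 (cK t st) (h0 t x st).
  lra.
- move=> x.
  rewrite subrr mulr0 expR0 subrr mulr0 oppr0 mul0r addr0 (bcs_initial vS) (bcs_initial uS).
  move: (powR_ge0 `|f x| p); set g := _ `^ _; rewrite le_eqVlt => /predU1P[<-|g0].
    by rewrite mul0r !add0r mulN1r subrr.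
  have l1 : ln g <= ln (g + e) by rewrite ler_ln ?posrE ?addr_gt0 // lerDl ltW.
  have l2 : ln e <= ln (g + e) by rewrite ler_ln ?posrE ?addr_gt0 // lerDr ltW.
  have := ler_wpM2l (ltW g0) l1; have := ler_wpM2l (ltW e0) l2; lra.
- move=> t x st.
  rewrite e6 // e4 // vh // e3 opA_cst oppr0 !add0r e5 // e2 // eh // e1 // hh // mulr0 add0r.
  rewrite mulrN mulN1r opprK.
  have It : I t by exact: setting_upper setting _ _ Is (ltW st).
  have := Qle t (grad (u t) x) It; have := gradient_bound f1 p2 Is uS hS x st.
  move: (quad_form _ _) (enorm _ ^+ 2) (u0 t x (ltW st)) (h0 t x (ltW st)) => q n.
  move: (expR_ge0 (2 * r0 * (t - s))) KE; set E := expR _; set U := u t x; set H := h t x.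
  rewrite ltr0_norm // => E0 KE U0 H0; exact: (entropy_arith e0 L0 r0n KE).
Qed.

End LogSobolev.

(** The function [r ln r] is continuous at [u] and at 0, so [e] may tend to 0. *)
Lemma le_of_entropy_limit {R : realType} (c u v : R) : 0 <= u ->
  (forall e, 0 < e -> v + e * ln e <= c + (u + e) * ln (u + e)) -> v <= c + u * ln u.
Proof.
move=> u0 H; rewrite leNgt; apply/negP => lt.
pose F e := `|u + e| * ln `|u + e| - `|e| * ln `|e|.
have cF : {for (0 : R), continuous F}.
  have c1 : u + e @[e --> (0 : R)] --> u + 0 by exact: (cvgD (cvg_cst _) cvg_id).
  exact: (cvgB (cvg_comp _ _ c1 (@continuous_xlnx R _)) (@continuous_xlnx R 0)).
have e0 : 0 < v - (c + u * ln u) by rewrite subr_gt0.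
move/cvgrPdist_lt : cF => /(_ _ e0) /nbhs_normP [r /= r0 Hr].
have r20 : 0 < r / 2 by rewrite divr_gt0.
have /Hr : ball_ Num.norm 0 r (r / 2).
  by rewrite /= sub0r normrN gtr0_norm // ltr_pdivrMr // ltr_pMr // ltr1n.
rewrite /= /F addr0 normr0 mul0r subr0 (ger0_norm u0) (gtr0_norm r20) (gtr0_norm (ltr_wpDl u0 r20)).
rewrite ltr_norml => /andP[+ _]; have := H _ r20; lra.
Qed.

Lemma ellipticity_posdef {R : realType} {d : nat} (M : 'M[R]_d) (eta0 : R) : 0 < eta0 ->
  (forall xi, eta0 * enorm xi ^+ 2 <= quad_form M xi) ->
  forall xi : 'rV[R]_d, xi != 0 -> 0 < quad_form M xi.
Proof.
move=> e0 H xi xi0; apply: lt_le_trans (H xi); rewrite mulr_gt0 // exprn_gt0 //.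
by apply: lt_le_trans (le_norm_enorm xi); rewrite normr_gt0.
Qed.

Unset Implicit Arguments.

(* [ln 0 = 0] in the library, so [0 * ln 0 = 0] as required. *)
Theorem proposition3p2 (R : realType) (d : nat) (hd : (0 < d)%N)
  (I : set R) (hI : open_right_halfline I)
  (theta : R) (htheta : 0 < theta < 1)
  (Q : R -> 'M[R]_d) (b : R -> 'rV[R]_d -> 'rV[R]_d)
  (hreg : coef_regular Q b theta I)
  (eta0 Lambda : R) (heta0 : 0 < eta0) (hLambda : eta0 < Lambda)
  (hell : uniformly_elliptic Q eta0 Lambda I)
  (hlyap : has_lyapunov Q b I)
  (r0 : R) (hr0 : r0 < 0)
  (hdiss : drift_dissipative b theta r0 I)
  (G : R -> R -> ('rV[R]_d -> R) -> 'rV[R]_d -> R)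
  (hG : evolution_operator Q b theta I G) :
  forall (f : 'rV[R]_d -> R) (p s t : R),
    C1b f -> 2 <= p -> I s -> I t -> s <= t ->
    forall x : 'rV[R]_d,
      G t s (fun y => `|f y| `^ p * ln (`|f y| `^ p)) x
      <= p ^+ 2 * Lambda / `|r0| * (1 - expR (2 * r0 * (t - s)))
           * G t s (fun y => `|f y| `^ (p - 2) * enorm (grad f y) ^+ 2) x
         + G t s (fun y => `|f y| `^ p) x * ln (G t s (fun y => `|f y| `^ p) x).
Proof.
move=> f p s t f1 p2 Is It st x.
have theta0 : 0 < theta by case/andP: htheta.
have [phi [a [gamma [[phi2 phi0] coer [a0 gamma0] phiA]]]] := hlyap.
have setting : dissipative_setting Q b I phi a r0.
  have [c IE] := hI; split => //.
  - by move=> s' t'; rewrite IE /= !in_itv /= !andbT; exact: lt_le_trans.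
  - by move=> t' It'; have [] := hell t' It'.
  - move=> t' It'; apply: ellipticity_posdef heta0 _ => xi.
    by have [_ /(_ xi) /andP[]] := hell t' It'.
  - by move=> t' y z It'; exact: drift_monotone theta0 hreg.2 hdiss It'.
  - move=> t' y It'; apply: le_trans (phiA t' y It') _.
    by rewrite gerBl mulr_ge0 // ltW // phi0.
have Cf : Cb f by have [f11 bf _] := f1; split => //; exact: f11.1.
have p0 : 0 <= p by lra.
have q0 : 0 <= p - 2 by lra.
have Cu : Cb (fun y => `|f y| `^ p) := Cb_comp Cf (continuous_norm_powR p0).
have Ch : Cb (fun y => `|f y| `^ (p - 2) * enorm (grad f y) ^+ 2) :=
  CbM (Cb_comp Cf (continuous_norm_powR q0)) (Cb_sqr_grad f1).
have Cv : Cb (fun y => `|f y| `^ p * ln (`|f y| `^ p)).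
  have -> : (fun y => `|f y| `^ p * ln (`|f y| `^ p)) =
      (fun y => `| `|f y| `^ p | * ln `| `|f y| `^ p |).
    by apply/funext => y; rewrite (ger0_norm (powR_ge0 `|f y| p)).
  exact: Cb_comp Cu (@continuous_xlnx R).
have Qle t' xi : I t' -> quad_form (Q t') xi <= Lambda * enorm xi ^+ 2.
  by move=> It'; have [_ /(_ xi) /andP[]] := hell t' It'.
have L0 : 0 <= Lambda by rewrite ltW // (lt_trans heta0).
apply: le_of_entropy_limit => [|e e0].
  by apply: (solution_ge0 setting theta0 Is (hG _ _ Is Cu)) => // y; exact: powR_ge0.
exact: (entropy_comparison setting theta0 f1 p2 Is hr0 L0 Qle
  (hG _ _ Is Cu) (hG _ _ Is Cv) (hG _ _ Is Ch) erefl x e0 st).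
Qed.
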